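(* Let $g$ be Landau's function and let $1=n_1<n_2<n_3<\cdots$ be the increasing sequence of the positive integers at which $g$ takes a strictly larger value than at the preceding integer, i.e. $g(n_k)>g(n_k-1)$. Then $$\liminf_{k\to\infty}\,(n_{k+1}-n_k)<+\infty .$$
   Context: For a positive integer $n$, Landau's function $g(n)$ is the maximal order of an element of the symmetric group $S_n$ on $n$ letters; equivalently $g(n)=\max \operatorname{lcm}(m_1,\dots,m_k)$ over all partitions $n=m_1+\cdots+m_k$ of $n$. The function $g$ is non-decreasing and unbounded. The sequence $(n_k)_{k\ge 1}$ starts with $n_1=1$ (by convention) and for $k\ge 2$ lists in increasing order all integers $n\ge 2$ with $g(n)>g(n-1)$; thus $n_1=1,n_2=2,n_3=3,n_4=4,n_5=5,n_6=7,\dots$. *)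

(* Defs.v *)
From mathcomp Require Import all_boot all_fingroup.

Set Implicit Arguments.
Unset Strict Implicit.
Unset Printing Implicit Defensive.

Definition landau (n : nat) : nat := \max_(s : 'S_n) #[s]%g.

Lemma landau_ge n : n <= landau n.
Proof.
case: n => [//|n].
pose s : 'S_n.+1 := perm (can_inj (@ordSK n.+1)).
apply: leq_trans (leq_bigmax s).
have sX k : k < n.+1 -> (s ^+ k)%g ord0 = k :> nat.
  elim: k => [|k IHk] ltkn; first by rewrite expg0 perm1.
  by rewrite expgSr permM permE /= IHk ?modn_small // ltnW.
rewrite leqNgt; apply/negP => lt_s.
have := sX _ lt_s; rewrite expg_order perm1 /= => /eqP.
by rewrite eq_sym eqn0Ngt order_gt0.
Qed.

Definition landau_jump (n : nat) : bool := landau n.-1 < landau n.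

Lemma landau_jump_exists m : exists n, (m < n) && landau_jump n.
Proof.
pose N := (m + landau m).+1.
case: (boolP [exists n : 'I_N.+1, (m < n) && landau_jump n]) => [/existsP[n Pn]|].
  by exists n.
rewrite negb_exists => /forallP noJ.
have le_g d : m + d <= N -> landau (m + d) <= landau m.
  elim: d => [|d IHd] led; first by rewrite addn0.
  have := noJ (Ordinal (led : m + d.+1 < N.+1)).
  rewrite /= /landau_jump addnS ltnS leq_addr /= -leqNgt => /leq_trans; apply.
  by apply: IHd; apply: leq_trans led; rewrite leq_add2l.
have /le_g : m + (landau m).+1 <= N by rewrite addnS.
by move/(leq_trans (landau_ge _)); rewrite addnS ltnNge leq_addl.
Qed.

(* The sequence is indexed from 0: landau_seq k is n_(k+1), and the first
   term 1 is a convention, as 1 is not a jump. *)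
Fixpoint landau_seq (k : nat) : nat :=
  if k is k'.+1 then ex_minn (landau_jump_exists (landau_seq k')) else 1.

(* Main.v *)
(** Write [ell M] for the sum of the prime powers exactly dividing [M]; then [landau n] is the
    largest [M] with [ell M <= n]. For a prime [P] put [rho = P / ln P] and let [N] maximise
    [M / exp (ell M / rho)]. If no prime power [p ^ j] with [j >= 2] is close to its threshold
    for entering [N], every [M >= N] with [ell M <= ell N + m], [m] much smaller than [sqrt P],
    arises from [N] by exchanging equally many primes near [P], and then
    [ln (M / N) = (ell M - ell N) / P] up to less than [1 / (2 P)]: the jumps just after [ell N]
    exceed it by exactly the values of (sum of primes put in) - (sum of primes taken out). It
    remains to find two such values at bounded positive distance. Near suitable [P] there are
    many short windows containing the expected proportion of primes. Let [D] be the gcd of the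
    differences of primes occurring in many windows. Combining such differences from distinct
    windows realises [D] as a difference of two sums of primes; on the other hand some window
    has all its primes congruent modulo [D], and Selberg's upper bound sieve then forces
    [D = O(1)]. In particular no result on bounded gaps between consecutive primes is needed. *)

Require Import Defs.
From mathcomp Require Import all_boot all_fingroup all_solvable all_order all_algebra.
From mathcomp Require Import all_classical all_reals all_analysis.
From mathcomp Require Import zify ring lra.

Set Implicit Arguments.
Unset Strict Implicit.
Unset Printing Implicit Defensive.

(** The existence of primes enters only through Chebyshev's lower bound, an average statement, so
    windows and blocks are found by counting. All lengths are powers of one scale
    [H = 2 ^ (12 * i)]: windows have length [H], blocks length [H ^ 8], and everything stays below
    [H ^ 40]. The exponents come from a budget. Exchanging up to [4 * H ^ 3] primes within one block
    changes [ell] by at most [m = H ^ 12], and separating neighbouring values of [ell] takes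
    [64 * m ^ 2 < P], secured by [P >= H ^ 27]. The obstacle is the proviso on higher prime powers,
    which may fail for a given [P]. At most [H ^ 24] pairs [(p, j)] can be at fault, and each spoils
    at most [H ^ 6] blocks, because [P / ln P] grows with slope about [1 / ln P]. As [H ^ 31] blocks
    have enough dense windows, one of them escapes every pair. *)

(** * Landau's function as a maximum under a bound on [ell] *)

Definition ell (M : nat) : nat := \sum_(p <- primes M) p ^ logn p M.

(** A range independent of [M] allows comparison prime by prime; the factor [0 < logn p M] removes
    the spurious terms [p ^ 0 = 1]. *)
Lemma ell_widen M B : M < B ->
  ell M = \sum_(0 <= p < B) (0 < logn p M) * p ^ logn p M.
Proof.
move=> ltMB; rewrite /ell -(filter_pi_of ltMB) big_filter big_mkcond /=.
by apply: eq_bigr => p _; rewrite /pi_of logn_gt0; case: ifP => _; rewrite ?mul1n.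
Qed.

Lemma ell_dvd a b : 0 < b -> a %| b -> ell a <= ell b.
Proof.
move=> b_gt0 dvd_ab; have leab := dvdn_leq b_gt0 dvd_ab.
rewrite (@ell_widen a b.+1) // (@ell_widen b b.+1) //; apply: leq_sum => p _.
have le_log := dvdn_leq_log p b_gt0 dvd_ab.
case: posnP => //= log_gt0; rewrite (leq_trans log_gt0) // !mul1n.
rewrite leq_pexp2l // prime_gt0 //.
by move: log_gt0; rewrite logn_gt0 mem_primes => /andP[].
Qed.

Lemma ell_lcm a b : 0 < a -> 0 < b -> ell (lcmn a b) <= ell a + ell b.
Proof.
move=> a_gt0 b_gt0; have l_gt0 : 0 < lcmn a b by rewrite lcmn_gt0 a_gt0.
have lea := dvdn_leq l_gt0 (dvdn_lcml a b).
have leb := dvdn_leq l_gt0 (dvdn_lcmr a b).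
rewrite !(@ell_widen _ (lcmn a b).+1) // -big_split /=; apply: leq_sum => p _.
rewrite logn_lcm // /maxn; case: ifP => _; first exact: leq_addl.
exact: leq_addr.
Qed.

Lemma leq_sum_prod (I : eqType) (r : seq I) (F : I -> nat) :
  (forall i, i \in r -> 1 < F i) -> \sum_(i <- r) F i <= \prod_(i <- r) F i.
Proof.
elim: r => [|i r IHr] F_gt1; first by rewrite !big_nil.
rewrite !big_cons; have Fi := F_gt1 i (mem_head i r).
have /IHr le_r : forall j, j \in r -> 1 < F j.
  by move=> j jr; rewrite F_gt1 // inE jr orbT.
case: r {IHr} F_gt1 le_r => [|j r] F_gt1; first by rewrite !big_nil; lia.
have Pgt : 1 < \prod_(k <- j :: r) F k.
  rewrite big_cons; have Fj : 1 < F j by rewrite F_gt1 // !inE eqxx orbT.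
  apply: leq_trans Fj _; rewrite leq_pmulr // big_seq_cond prodn_cond_gt0 // => k.
  by rewrite andbT => kr; rewrite ltnW // F_gt1 // !inE kr !orbT.
by move: Pgt; move: (\sum_(_ <- _) _) (\prod_(_ <- _) _) => x y; nia.
Qed.

Lemma prod_primes n : 0 < n -> \prod_(p <- primes n) p ^ logn p n = n.
Proof.
move=> n_gt0; rewrite -[RHS]partnT // (@widen_partn n) //.
rewrite -(filter_pi_of (leqnn n.+1)) big_filter big_mkcond /=.
apply: eq_bigr => p _; case: ifPn => //.
by rewrite /pi_of -logn_gt0 -eqn0Ngt => /eqP ->.
Qed.

Lemma ell_leq a : 0 < a -> ell a <= a.
Proof.
move=> a_gt0; rewrite -{2}(prod_primes a_gt0).
apply: leq_sum_prod => p; rewrite -logn_gt0 => log_gt0.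
by move: (log_gt0); rewrite logn_gt0 mem_primes => /andP[/prime_gt1 ? _];
  rewrite -{1}(exp1n (logn p a)) ltn_exp2r.
Qed.

Lemma ell_biglcm (I : eqType) (r : seq I) (F : I -> nat) :
  (forall i, i \in r -> 0 < F i) ->
  ell (\big[lcmn/1]_(i <- r) F i) <= \sum_(i <- r) F i.
Proof.
elim: r => [|i r IHr] F_gt0; first by rewrite !big_nil /ell big_nil.
have F_gt0' j : j \in r -> 0 < F j.
  by move=> jr; apply: F_gt0; rewrite inE jr orbT.
rewrite !big_cons; apply: leq_trans (ell_lcm (F_gt0 i (mem_head i r)) _) _.
  rewrite big_seq; elim/big_ind: _ => // x y ? ?.
  by rewrite lcmn_gt0; apply/andP.
by apply: leq_add; [apply: ell_leq; rewrite F_gt0 ?mem_head | exact: IHr].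
Qed.

(** The map [f] lets [s] and [t] act side by side, so its powers restrict to the powers of each. *)
Lemma perm_join m n (s : 'S_m) (t : 'S_n) :
  exists u : 'S_(m + n), #[s]%g %| #[u]%g /\ #[t]%g %| #[u]%g.
Proof.
pose f (i : 'I_(m + n)) := match fintype.split i with
  | inl j => lshift n (s j) | inr k => rshift m (t k) end.
have fl j : f (lshift n j) = lshift n (s j).
  by rewrite /f -[lshift n j]/(unsplit (inl j)) unsplitK.
have fr j : f (rshift m j) = rshift m (t j).
  by rewrite /f -[rshift m j]/(unsplit (inr j)) unsplitK.
have f_inj : injective f.
  move=> i j; rewrite -(splitK i) -(splitK j).
  case: (fintype.split i) => a; case: (fintype.split j) => b; rewrite /= ?fl ?fr.
  - by move/lshift_inj/perm_inj->.
  - by move/eqP; rewrite eq_lrshift.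
  - by move/eqP; rewrite eq_rlshift.
  - by move/rshift_inj/perm_inj->.
exists (perm f_inj).
have ul k j : (perm f_inj ^+ k)%g (lshift n j) = lshift n ((s ^+ k)%g j).
  by elim: k => [|k IHk]; rewrite ?expg0 ?perm1 // !expgSr !permM IHk permE fl.
have ur k j : (perm f_inj ^+ k)%g (rshift m j) = rshift m ((t ^+ k)%g j).
  by elim: k => [|k IHk]; rewrite ?expg0 ?perm1 // !expgSr !permM IHk permE fr.
split; rewrite order_dvdn; apply/eqP/permP => j.
  by apply: (@lshift_inj m n); rewrite -ul expg_order !perm1.
by apply: (@rshift_inj m n); rewrite -ur expg_order !perm1.
Qed.

Lemma perm_full_cycle n : 0 < n -> exists s : 'S_n, n %| #[s]%g.
Proof.
case: n => // n _; pose s : 'S_n.+1 := perm (can_inj (@ordSK n.+1)).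
have sX k : (s ^+ k)%g ord0 = k %% n.+1 :> nat.
  elim: k => [|k IHk]; first by rewrite expg0 perm1 mod0n.
  by rewrite expgSr permM permE /= IHk -addn1 modnDml addn1.
by exists s; rewrite /dvdn -sX expg_order perm1.
Qed.

Lemma perm_cycles (ms : seq nat) : (forall m, m \in ms -> 0 < m) ->
  exists u : 'S_(sumn ms), forall m, m \in ms -> m %| #[u]%g.
Proof.
elim: ms => [|m ms IHms] ms_gt0; first by exists 1%g.
have [t tP] : exists u : 'S_(sumn ms), forall m, m \in ms -> m %| #[u]%g.
  by apply: IHms => k ?; rewrite ms_gt0 // inE orbC; apply/orP; left.
have [s sP] := perm_full_cycle (ms_gt0 m (mem_head m ms)).
have [u [su tu]] := perm_join s t.
exists u => k; rewrite inE => /predU1P[->|/tP]; first exact: dvdn_trans su.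
by move=> /dvdn_trans; apply.
Qed.

(** One cycle of length [p ^ logn p M] for each prime factor, with the remaining points fixed, has
    order divisible by [M]. *)
Lemma leq_landau M n : 0 < M -> ell M <= n -> M <= landau n.
Proof.
move=> M_gt0 le_n; pose ms := [seq p ^ logn p M | p <- primes M].
have ms_gt0 m : m \in ms -> 0 < m.
  by case/mapP => p; rewrite mem_primes => /andP[/prime_gt0 p_gt0 _] ->;
     rewrite expn_gt0 p_gt0.
have [u uP] := perm_cycles ms_gt0.
have le_ms : sumn ms <= n by rewrite sumnE big_map.
have [v [uv _]] := perm_join u (1%g : 'S_(n - sumn ms)).
rewrite subnKC // in v uv.
apply: leq_trans (leq_bigmax v).
apply: dvdn_leq; rewrite ?order_gt0 //; apply: dvdn_trans uv.
apply/(dvdn_partP _ M_gt0) => p p_pi.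
by rewrite p_part uP //; apply: map_f.
Qed.

(** The order divides the lcm of the orbit lengths. As [ell] is monotone under divisibility,
    subadditive under lcm and satisfies [ell a <= a], it is at most the total length of the
    orbits. *)
Lemma perm_order_ell n (s : 'S_n) : ell #[s]%g <= n.
Proof.
pose L := \big[lcmn/1]_(X in porbits s) #|X|.
have Lg : 0 < L.
  rewrite /L; elim/big_ind: _ => [|x y ? ?|X /imsetP[x _ ->]] //.
    by rewrite lcmn_gt0; apply/andP.
  by rewrite lt0n card_porbit_neq0.
have dvdL : #[s]%g %| L.
  rewrite order_dvdn; apply/eqP/permP => x; rewrite perm1.
  have : #|porbit s x| %| L.
    by rewrite /L (bigD1 (porbit s x)) ?dvdn_lcml // imset_f.
  case/dvdnP => k ->; rewrite mulnC permX.
  by elim: k => [|k IHk]; rewrite ?muln0 // mulnS iterD IHk iter_porbit.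
apply: leq_trans (ell_dvd Lg dvdL) _.
have /leq_trans-> // : ell L <= \sum_(X in porbits s) #|X|.
  rewrite /L -!big_enum /=.
  apply: ell_biglcm => X; rewrite mem_enum => /imsetP[x _ ->].
  by rewrite lt0n card_porbit_neq0.
rewrite -[leqRHS](card_ord n) -sum1_card.
rewrite (partition_big (porbit s) (mem (porbits s))) /=; last first.
  by move=> x _; rewrite imset_f.
apply: leq_sum => X /imsetP[x _ ->]; rewrite sum1_card.
apply: subset_leq_card; apply/fintype.subsetP => y.
by rewrite -eq_porbit_mem unfold_in.
Qed.

Lemma landau_witness n : exists M, [/\ 0 < M, ell M <= n & landau n = M].
Proof.
rewrite /landau; have [|s ->] := eq_bigmax (fun s : 'S_n => #[s]%g).
  by rewrite card_Sn fact_gt0.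
by exists #[s]%g; rewrite order_gt0 perm_order_ell.
Qed.

Lemma landau_leq m n : m <= n -> landau m <= landau n.
Proof.
have [M [M_gt0 leM ->]] := landau_witness m => /(leq_trans leM).
exact: leq_landau.
Qed.

Import Order.TTheory GRing.Theory Num.Theory.

(** * Gaps and jumps *)

Lemma landau_seqP k : [/\ landau_seq k < landau_seq k.+1, landau_jump (landau_seq k.+1) &
  forall n, landau_seq k < n -> landau_jump n -> landau_seq k.+1 <= n].
Proof.
rewrite /=; case: ex_minnP => m /andP[ltm Jm] min_m; split=> // n ltn Jn.
by apply: min_m; rewrite ltn.
Qed.

Lemma landau_seq_gt k : k < landau_seq k.
Proof.
by elim: k => // k IHk; have [lt _ _] := landau_seqP k; apply: leq_ltn_trans lt.
Qed.

Lemma landau_seq_leq j k : j <= k -> landau_seq j <= landau_seq k.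
Proof.
elim: k => [|k IHk]; first by rewrite leqn0 => /eqP->.
rewrite leq_eqVlt => /predU1P[->//|/IHk /leq_trans]; apply.
by have [/ltnW] := landau_seqP k.
Qed.

Lemma landau_seq_onto n : 1 < n -> landau_jump n -> exists k, landau_seq k = n.
Proof.
move=> n_gt1 Jn.
have ex_k : exists k, n <= landau_seq k by exists n; rewrite ltnW ?landau_seq_gt.
case: (ex_minnP ex_k) => -[|k] len min_k; first by move: n_gt1; rewrite ltnNge len.
have [lt_k _ leq_k] := landau_seqP k; exists k.+1.
have ltn : landau_seq k < n.
  by rewrite ltnNge; apply/negP => /min_k; rewrite ltnn.
by apply/eqP; rewrite eqn_leq len leq_k.
Qed.

Lemma landau_jump_between n1 n2 : landau n1 < landau n2 ->
  exists2 n, n1 < n <= n2 & landau_jump n.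
Proof.
elim: n2 => [|n2 IHn] lt12; first by have := landau_leq (leq0n n1); rewrite leqNgt lt12.
have [lt1|le1] := ltnP (landau n1) (landau n2).
  by have [n /andP[? le_n] Jn] := IHn lt1; exists n => //; apply/andP; split=> //; apply: leqW.
exists n2.+1; last exact: leq_ltn_trans le1 lt12.
by rewrite leqnn andbT ltnNge; apply/negP => /landau_leq; rewrite leqNgt lt12.
Qed.

Lemma landau_seq_close C n1 n2 K : landau_seq K < n1 -> n2 <= n1 + C ->
  landau_jump n1 -> landau n1 < landau n2 ->
  exists2 k, K <= k & landau_seq k.+1 <= landau_seq k + C.
Proof.
move=> ltK le2 J1 lt12; have n1_gt1 : 1 < n1.
  by apply: leq_ltn_trans ltK; apply: leq_ltn_trans (landau_seq_gt K).
have [k def_n1] := landau_seq_onto n1_gt1 J1.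
have [n /andP[lt1 le_n] Jn] := landau_jump_between lt12.
exists k.
  by rewrite leqNgt; apply/negP => /ltnW/landau_seq_leq; rewrite def_n1 leqNgt ltK.
have [_ _ min_k] := landau_seqP k.
rewrite def_n1; apply: leq_trans le2; apply: leq_trans le_n.
by apply: min_k => //; rewrite def_n1.
Qed.

Lemma limn_einf_bounded_often (R : realType) (u : (\bar R)^nat) (c : \bar R) :
  (forall K, exists2 k, K <= k & (u k <= c)%E) -> (limn_einf u <= c)%E.
Proof.
move=> often; rewrite limn_einf_lim; apply: lime_le; first exact: is_cvg_einfs.
apply: nearW => n; have [k le_nk le_uk] := often n.
by apply: le_trans le_uk; apply: ereal_inf_lbound; exists k.
Qed.

Theorem limn_einf_gaps_of_close_jumps (R : realType) : (exists C, forall K, exists n1 n2,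
    [/\ K < n1, n2 <= n1 + C, landau_jump n1 & landau n1 < landau n2]) ->
  (limn_einf (fun k : nat =>
     ((landau_seq k.+1)%:R - (landau_seq k)%:R : R)%R%:E) < +oo)%E.
Proof.
case=> C close; apply: le_lt_trans (ltry (C%:R : R)).
apply: limn_einf_bounded_often => K.
have [n1 [n2 [ltK le2 J1 lt12]]] := close (landau_seq K).
have [k leK lek] := landau_seq_close ltK le2 J1 lt12.
by exists k => //; rewrite lee_fin lerBlDl -natrD ler_nat.
Qed.

(** * An upper bound sieve *)

Definition sqfree (e : nat) : bool :=
  (0 < e) && all (fun p => logn p e == 1) (primes e).

Lemma prod_primes_sqfree e : sqfree e -> \prod_(p <- primes e) p = e.
Proof.
case/andP=> e_gt0 /allP le1; rewrite -[RHS]prod_primes //.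
by apply: eq_big_seq => p /le1 /eqP->; rewrite expn1.
Qed.

Lemma sqfree_decomp n : 0 < n -> exists e f, [/\ sqfree e, 0 < f & n = e * f ^ 2].
Proof.
elim/ltn_ind: n => n IHn n_gt0.
have [sf|] := boolP (sqfree n); first by exists n, 1; rewrite exp1n muln1.
rewrite /sqfree n_gt0 /= => /allPn[p pn log_neq1].
have p_pr : prime p by move: pn; rewrite mem_primes => /andP[].
have log_gt1 : 1 < logn p n by rewrite ltn_neqAle eq_sym log_neq1 logn_gt0.
have /dvdnP[k def_n] : p ^ 2 %| n by rewrite pfactor_dvdn.
have k_gt0 : 0 < k by rewrite lt0n; apply: contraL n_gt0; rewrite def_n => /eqP->.
have p_gt1 := prime_gt1 p_pr.
have [|//|e [f [sf f_gt0 def_k]]] := IHn k.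
  by rewrite def_n -{1}[k]muln1 ltn_pmul2l // -[1](exp1n 2) ltn_exp2r.
exists e, (f * p); split=> //; first by rewrite muln_gt0 f_gt0 prime_gt0.
by rewrite def_n def_k expnMn mulnA.
Qed.

Local Open Scope ring_scope.

(** * Sums of periodic functions *)

Section PeriodicSums.
Variable R : realFieldType.

Lemma sum_crt (p q : nat) (f g : nat -> R) : (0 < p)%N -> (0 < q)%N ->
  coprime p q -> (forall n, f (n %% p)%N = f n) -> (forall n, g (n %% q)%N = g n) ->
  \sum_(0 <= n < p * q) f n * g n =
  (\sum_(0 <= n < p) f n) * (\sum_(0 <= n < q) g n).
Proof.
move=> p_gt0 q_gt0 co_pq fp gq; rewrite !big_mkord big_distrlr /=.
rewrite pair_big /=.
pose h (n : 'I_(p * q)) : 'I_p * 'I_q :=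
  (Ordinal (ltn_pmod n p_gt0), Ordinal (ltn_pmod n q_gt0)).
have h_inj : injective h.
  move=> m n /eqP; rewrite xpair_eqE => /andP[/eqP[emp] /eqP[emq]].
  apply/val_inj/eqP; rewrite /= -(modn_small (ltn_ord m)) -(modn_small (ltn_ord n)).
  by rewrite chinese_remainder // emp emq !eqxx.
have h_bij : bijective h by apply: inj_card_bij; rewrite // card_prod !card_ord.
rewrite (reindex h) /=; last exact: onW_bij.
by apply: eq_bigr => n _; rewrite fp gq.
Qed.

Lemma periodic_prod (u : seq nat) (F : nat -> nat -> R) :
  (forall p, p \in u -> forall n, F p (n %% p)%N = F p n) ->
  forall n, \prod_(p <- u) F p (n %% \prod_(p <- u) p)%N = \prod_(p <- u) F p n.
Proof.
move=> FP n; apply: eq_big_seq => p pu; rewrite -[LHS]FP // -[RHS]FP //.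
by rewrite modn_dvdm //; rewrite (big_rem p) //= dvdn_mulr.
Qed.

Lemma sum_prod_crt (u : seq nat) (F : nat -> nat -> R) :
  uniq u -> (forall p, p \in u -> prime p) ->
  (forall p, p \in u -> forall n, F p (n %% p)%N = F p n) ->
  \sum_(0 <= n < (\prod_(p <- u) p)%N) \prod_(p <- u) F p n =
  \prod_(p <- u) \sum_(0 <= n < p) F p n.
Proof.
elim: u => [|p u IHu] /=; first by rewrite !big_nil big_nat1 big_nil.
case/andP=> pu uniq_u u_pr FP.
have u_pr' q : q \in u -> prime q by move=> qu; apply: u_pr; rewrite inE qu orbT.
have FP' q : q \in u -> forall n, F q (n %% q)%N = F q n.
  by move=> qu; apply: FP; rewrite inE qu orbT.
have p_pr := u_pr p (mem_head p u).
have prod_gt0 : (0 < \prod_(q <- u) q)%N.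
  by rewrite big_seq prodn_cond_gt0 // => q /u_pr' /prime_gt0.
have co_p : coprime p (\prod_(q <- u) q).
  rewrite big_seq; elim/big_ind: _ => [|x y cx cy|q qu]; first exact: coprimen1.
    by rewrite coprimeMr cx.
  rewrite prime_coprime // (dvdn_prime2 p_pr (u_pr' q qu)).
  by apply: contraNneq pu => ->.
rewrite [RHS]big_cons -IHu // (big_cons _ _ p u predT id) /=.
apply: etrans (sum_crt (prime_gt0 p_pr) prod_gt0 co_p (FP p (mem_head p u)) (periodic_prod FP')).
by apply: eq_bigr => n _; rewrite big_cons.
Qed.

(** Each full period contributes at most [s * q], the last incomplete one at most [c * q]. *)
Lemma periodic_sum_le (q : nat) (h : nat -> R) (s c : R) : (0 < q)%N ->
  (forall n, h (n %% q)%N = h n) -> 0 <= s -> (forall n, h n <= c) -> 0 <= c ->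
  \sum_(0 <= n < q) h n <= s * q%:R ->
  forall K, \sum_(0 <= n < K) h n <= s * K%:R + c * q%:R.
Proof.
move=> q_gt0 hq s_ge0 hc c_ge0 sum_q; elim/ltn_ind => K IHK.
have [ltKq|leqK] := ltnP K q.
  apply: (@le_trans _ _ (c * K%:R)).
    rewrite mulr_natr -[K in c *+ K]subn0 -sumr_const_nat.
    by apply: ler_sum => n _; apply: hc.
  rewrite -[leLHS]add0r lerD ?mulr_ge0 ?ler0n //.
  by rewrite ler_wpM2l // ler_nat ltnW.
have -> : \sum_(0 <= n < K) h n =
    \sum_(0 <= n < q) h n + \sum_(0 <= n < K - q) h n.
  rewrite (@big_cat_nat _ _ _ q) //=; congr (_ + _).
  rewrite -{1}[q]add0n big_addn; apply: eq_bigr => n _.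
  by rewrite -hq modnDr hq.
have ltKq : (K - q < K)%N by rewrite ltn_subrL q_gt0 (leq_trans q_gt0).
apply: le_trans (lerD sum_q (IHK _ ltKq)) _.
by rewrite addrA -mulrDr -natrD subnKC.
Qed.

End PeriodicSums.

Section Sieve.
Variables (R : realFieldType) (a D : nat).

(* For [p] prime to [D], [1 - p * 1_(p | a + k D)] has mean zero as a function of [k] mod [p]. *)
Definition sieve_char (p k : nat) : R := 1 - (p %| a + k * D)%N%:R * p%:R.

Lemma sieve_char_mod p k : sieve_char p (k %% p)%N = sieve_char p k.
Proof.
rewrite /sieve_char; congr (1 - _%:R * _).
by rewrite /dvdn -modnDmr modnMml modnDmr.
Qed.

(** As [D] is invertible modulo [p], the map sending [k] to [a + k * D] permutes the residues and
    meets 0 once. *)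
Lemma sum_dvd_progression p : prime p -> coprime p D ->
  \sum_(0 <= k < p) (p %| a + k * D)%N%:R = 1 :> R.
Proof.
move=> p_pr co_pD; have p_gt0 := prime_gt0 p_pr.
pose h (k : 'I_p) : 'I_p := Ordinal (ltn_pmod (a + k * D) p_gt0).
have h_inj : injective h.
  move=> k l [/eqP]; rewrite eqn_modDl => /eqP.
  wlog le_kl : k l / (k <= l)%N => [hw|].
    by case/orP: (leq_total k l) => [/hw//|le_lk] e; rewrite (hw l k).
  move/esym/eqP; rewrite eqn_mod_dvd ?leq_mul // -mulnBl Gauss_dvdl //.
  move=> dvd_p; apply/val_inj/eqP; rewrite /= eqn_leq le_kl /= -subn_eq0.
  rewrite eqn0Ngt; apply/negP => /dvdn_leq/(_ dvd_p).
  by rewrite leqNgt ltn_subLR // (leq_trans (ltn_ord l)) ?leq_addl.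
have h_bij : bijective h by apply: inj_card_bij.
rewrite big_mkord (eq_bigr (fun k => (val (h k) == 0)%N%:R)) //.
rewrite -(reindex h (P := predT) (F := fun k : 'I_p => (val k == 0)%N%:R)) /=; last exact: onW_bij.
rewrite (bigD1 (Ordinal p_gt0)) //= big1 ?addr0 // => k.
by rewrite -val_eqE /= => /negPf->.
Qed.

Lemma sum_sieve_char p : prime p -> coprime p D ->
  \sum_(0 <= k < p) sieve_char p k = 0.
Proof.
move=> p_pr co_pD; rewrite sumrB -mulr_suml sum_dvd_progression //.
by rewrite sumr_const_nat subn0 mul1r subrr.
Qed.

Lemma sum_sieve_char_sqr p : prime p -> coprime p D ->
  \sum_(0 <= k < p) sieve_char p k ^+ 2 <= p%:R ^+ 2.
Proof.
move=> p_pr co_pD.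
have sqE k : sieve_char p k ^+ 2 = 1 + (p %| a + k * D)%N%:R * (p%:R ^+ 2 - p%:R *+ 2).
  by rewrite /sieve_char; case: (_ %| _)%N => /=; ring.
rewrite (eq_bigr _ (fun k _ => sqE k)) big_split /= -mulr_suml.
rewrite sum_dvd_progression // sumr_const_nat subn0.
by rewrite mul1r mulr2n; have : 0 <= p%:R :> R := ler0n _ _; lra.
Qed.

Lemma norm_sieve_char p k : prime p -> `|sieve_char p k| <= p%:R.
Proof.
move=> /prime_gt1 p_gt1; have p1 : 1 < p%:R :> R by rewrite ltr1n.
by rewrite /sieve_char ler_norml; case: (_ %| _)%N; rewrite /= ?mul1r ?mul0r; lra.
Qed.

(** For squarefree [e] this is [mu(e)] times Ramanujan's sum [c_e(a + k D)]. It equals 1 when no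
    prime factor of [e] divides [a + k * D]. *)
Definition sieve_prod (e k : nat) : R := \prod_(p <- primes e) sieve_char p k.

Lemma sieve_prod_le (e k : nat) : sqfree e -> `|sieve_prod e k| <= e%:R.
Proof.
move=> sf; rewrite /sieve_prod normr_prod -[leRHS](congr1 _ (prod_primes_sqfree sf)).
rewrite natr_prod !big_seq; apply: ler_prod => p; rewrite mem_primes => /andP[p_pr _].
by rewrite normr_ge0 norm_sieve_char.
Qed.

Lemma prod_sub_if (s u : seq nat) (G : nat -> R) : uniq s -> uniq u ->
  {subset s <= u} ->
  \prod_(p <- s) G p = \prod_(p <- u) (if p \in s then G p else 1).
Proof.
move=> uniq_s uniq_u sub_su; rewrite -[RHS]big_mkcond -[RHS]big_filter; apply: perm_big.
apply: uniq_perm; rewrite ?filter_uniq // => p; rewrite mem_filter.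
by case ps: (p \in s) => //=; rewrite sub_su.
Qed.

(** The sum over a period factorises by the Chinese remainder theorem. A prime dividing exactly one
    of [e] and [e'] contributes the factor 0; if [e = e'], the mean is at most [e]. Period and
    values are at most [z ^ 2], whence the error [z ^ 4]. *)
Lemma sieve_prod_quasi_orthogonal (e e' z K : nat) :
  sqfree e -> coprime e D -> (e <= z)%N ->
  sqfree e' -> coprime e' D -> (e' <= z)%N ->
  \sum_(0 <= k < K) sieve_prod e k * sieve_prod e' k <=
  (if e == e' then e%:R else 0) * K%:R + z%:R ^+ 4.
Proof.
move=> sf co_e le_e sf' co_e' le_e'.
pose u := primes e ++ [seq p <- primes e' | p \notin primes e].
have uniq_u : uniq u.
  rewrite cat_uniq primes_uniq filter_uniq ?primes_uniq // andbT /=.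
  by apply/hasPn => p; rewrite mem_filter => /andP[].
have sub_s : {subset primes e <= u} by move=> p ps; rewrite mem_cat ps.
have sub_t : {subset primes e' <= u}.
  by move=> p pt; rewrite mem_cat mem_filter pt andbT orbN.
have u_pr p : p \in u -> prime p.
  by rewrite mem_cat mem_filter !mem_primes => /orP[/andP[]|/andP[_ /andP[]]].
have u_co p : p \in u -> coprime p D.
  rewrite mem_cat mem_filter !mem_primes => /orP[|/andP[_]] /and3P[_ _ dvd_p].
    exact: coprime_dvdl co_e.
  exact: coprime_dvdl co_e'.
pose c (s : seq nat) p k := if p \in s then sieve_char p k else 1.
pose F p k := c (primes e) p k * c (primes e') p k.
have BE k : sieve_prod e k * sieve_prod e' k = \prod_(p <- u) F p k.
  by rewrite big_split /= /sieve_prod (prod_sub_if _ (primes_uniq e) uniq_u sub_s)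
             (prod_sub_if _ (primes_uniq e') uniq_u sub_t).
have FP p : p \in u -> forall n, F p (n %% p)%N = F p n.
  by move=> _ n; rewrite /F /c !sieve_char_mod.
set q := (\prod_(p <- u) p)%N.
have q_gt0 : (0 < q)%N by rewrite /q big_seq prodn_cond_gt0 // => p /u_pr /prime_gt0.
have le_q : (q <= z ^ 2)%N.
  rewrite /q big_cat /= (prod_primes_sqfree sf) expnS expn1 leq_mul //.
  apply: leq_trans le_e'; rewrite -[leqRHS](prod_primes_sqfree sf').
  rewrite big_filter big_mkcond /= !big_seq; apply: leq_prod => p.
  by rewrite mem_primes => /andP[/prime_gt0 ? _]; case: ifP.
have B_le k : sieve_prod e k * sieve_prod e' k <= z%:R ^+ 2.
  apply: le_trans (ler_norm _) _; rewrite normrM expr2 ler_pM //.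
    by apply: le_trans (sieve_prod_le _ sf) _; rewrite ler_nat.
  by apply: le_trans (sieve_prod_le _ sf') _; rewrite ler_nat.
have Bq n : sieve_prod e (n %% q) * sieve_prod e' (n %% q) = sieve_prod e n * sieve_prod e' n.
  by rewrite !BE; apply: periodic_prod.
pose s : R := if e == e' then e%:R else 0.
have s_ge0 : 0 <= s by rewrite /s; case: eqP.
apply: le_trans (periodic_sum_le q_gt0 Bq s_ge0 B_le _ _ K) _; rewrite ?exprn_ge0 //.
  rewrite (eq_bigr _ (fun k _ => BE k)) sum_prod_crt // /s.
  case: eqP => [ee'|ne_ee'].
    rewrite /q -{1}(prod_primes_sqfree sf).
    have -> : primes e = u.
      rewrite /u -ee' -[LHS]cats0; congr (_ ++ _).
      by rewrite (eq_in_filter (a2 := pred0)) ?filter_pred0 // => p ->.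
    rewrite !natr_prod -big_split /= !big_seq; apply: ler_prod => p pu.
    have p_pr := u_pr p pu; have pD := u_co p pu.
    have ps : p \in primes e.
      by move: pu; rewrite /u -ee' mem_cat mem_filter; case: (p \in primes e).
    rewrite (eq_bigr (fun k => sieve_char p k ^+ 2)); last first.
      by move=> k _; rewrite /F /c -ee' ps expr2.
    by rewrite -expr2 sum_sieve_char_sqr // andbT sumr_ge0 // => k _; rewrite sqr_ge0.
  rewrite mul0r le_eqVlt; apply/orP; left; apply/eqP.
  have [p pu neq_p] : exists2 p, p \in u & (p \in primes e) != (p \in primes e').
    apply/hasP; apply/negPn/negP => /hasPn all_eq; apply: ne_ee'.
    rewrite -(prod_primes_sqfree sf) -(prod_primes_sqfree sf').
    apply: perm_big; apply: uniq_perm; rewrite ?primes_uniq // => p.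
    have [/all_eq|pu] := boolP (p \in u); first by rewrite negbK => /eqP.
    by rewrite (negPf (contra (@sub_s p) pu)) (negPf (contra (@sub_t p) pu)).
  rewrite (big_rem p) //= [X in X * _](_ : _ = 0) ?mul0r //.
  rewrite -[RHS](sum_sieve_char (u_pr p pu) (u_co p pu)); apply: eq_bigr => k _.
  by move: neq_p; rewrite /F /c; do 2!case: (p \in _); rewrite ?mulr1 ?mul1r.
rewrite lerD2l -[4%N]/(2 + 2)%N exprD ler_wpM2l ?exprn_ge0 //.
by rewrite -natrX ler_nat.
Qed.

Definition sieve_mass (z : nat) : R :=
  \sum_(1 <= e < z.+1 | sqfree e && coprime e D) e%:R^-1.

Lemma sieve_mass_gt0 z : (0 < z)%N -> 0 < sieve_mass z.
Proof.
move=> z_gt0; rewrite /sieve_mass big_mkcond big_ltn //= coprime1n invr1.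
by rewrite ltr_pwDl // sumr_ge0 // => e _; case: ifP => // _; rewrite invr_ge0.
Qed.

(* Selberg's upper bound with the weights [1/(e * sieve_mass)], which lose only a constant
   against the optimal [1/(phi(e) * _)] and are elementary to evaluate. *)
Lemma sieve_upper_bound (z K : nat) : (0 < z)%N ->
  (\sum_(0 <= k < K) [forall p : 'I_z.+1, prime p ==> ~~ (p %| a + k * D)])%N%:R
  <= K%:R / sieve_mass z + z%:R ^+ 4.
Proof.
move=> z_gt0; have J_gt0 := sieve_mass_gt0 z_gt0; set J := sieve_mass z in J_gt0 *.
pose P e := sqfree e && coprime e D.
pose w k := \sum_(1 <= e < z.+1 | P e) (e%:R * J)^-1 * sieve_prod e k.
have sum_y : \sum_(1 <= e < z.+1 | P e) (e%:R * J)^-1 = 1.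
  rewrite (eq_bigr (fun e => e%:R^-1 * J^-1)) => [|e _]; last by rewrite invfM.
  by rewrite -mulr_suml mulfV // gt_eqF.
(* At a sifted [k] every [sieve_prod e k] is 1, so [w k] is the sum of the weights, which is 1;
   elsewhere the square is nonnegative. *)
have le_w : (\sum_(0 <= k < K) [forall p : 'I_z.+1, prime p ==> ~~ (p %| a + k * D)])%N%:R
    <= \sum_(0 <= k < K) w k ^+ 2.
  rewrite natr_sum; apply: ler_sum => k _.
  case: forallP => [sifted|_]; last by rewrite sqr_ge0.
  suff -> : w k = 1 by rewrite expr1n.
  rewrite -[RHS]sum_y /w big_seq_cond [RHS]big_seq_cond; apply: eq_bigr => e.
  rewrite mem_index_iota => /andP[/andP[e_gt0 lt_e] _].
  rewrite /sieve_prod big_seq big1 ?mulr1 // => p; rewrite mem_primes => /and3P[p_pr _ dvd_p].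
  have lt_p : (p < z.+1)%N by apply: leq_ltn_trans lt_e; apply: dvdn_leq.
  have /= := sifted (Ordinal lt_p); rewrite p_pr /= => /negPf ndvd.
  by rewrite /sieve_char ndvd mul0r subr0.
apply: le_trans le_w _.
have -> : \sum_(0 <= k < K) w k ^+ 2 =
    \sum_(1 <= e < z.+1 | P e) \sum_(1 <= e' < z.+1 | P e')
      (e%:R * J)^-1 * (e'%:R * J)^-1 * \sum_(0 <= k < K) sieve_prod e k * sieve_prod e' k.
  transitivity (\sum_(0 <= k < K) \sum_(1 <= e < z.+1 | P e) \sum_(1 <= e' < z.+1 | P e')
      (e%:R * J)^-1 * (e'%:R * J)^-1 * (sieve_prod e k * sieve_prod e' k)).
    apply: eq_bigr => k _; rewrite expr2 /w mulr_suml; apply: eq_bigr => e _.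
    by rewrite mulr_sumr; apply: eq_bigr => e' _; ring.
  rewrite exchange_big /=; apply: eq_bigr => e _.
  rewrite exchange_big /=; apply: eq_bigr => e' _.
  by apply/esym; exact: mulr_sumr.
apply: (@le_trans _ _ (\sum_(1 <= e < z.+1 | P e) \sum_(1 <= e' < z.+1 | P e')
   ((if e == e' then (e%:R * J)^-1 * J^-1 * K%:R else 0)
    + (e%:R * J)^-1 * (e'%:R * J)^-1 * z%:R ^+ 4))).
  rewrite big_seq_cond [leRHS]big_seq_cond; apply: ler_sum => e.
  rewrite mem_index_iota => /andP[/andP[e_gt0 lt_e] /andP[sf co_e]].
  rewrite big_seq_cond [leRHS]big_seq_cond; apply: ler_sum => e'.
  rewrite mem_index_iota => /andP[/andP[e'_gt0 lt_e'] /andP[sf' co_e']].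
  have y_ge0 n : 0 <= (n%:R * J)^-1 by rewrite invr_ge0 mulr_ge0 // ltW.
  apply: le_trans (ler_wpM2l (mulr_ge0 (y_ge0 e) (y_ge0 e'))
    (sieve_prod_quasi_orthogonal K sf co_e lt_e sf' co_e' lt_e')) _.
  rewrite mulrDr lerD2r; case: eqP => [<-|_]; last by rewrite mul0r mulr0.
  have e_neq0 : e%:R != 0 :> R by rewrite pnatr_eq0 -lt0n.
  have J_neq0 : J != 0 by rewrite gt_eqF.
  by rewrite le_eqVlt; apply/orP; left; apply/eqP; field; rewrite J_neq0 e_neq0.
rewrite le_eqVlt; apply/orP; left; apply/eqP.
under eq_bigr => e _ do rewrite big_split /=.
rewrite big_split /=; congr (_ + _); last first.
  under eq_bigr => e _ do rewrite -mulr_suml -mulr_sumr sum_y mulr1.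
  by rewrite -mulr_suml sum_y mul1r.
transitivity (\sum_(1 <= e < z.+1 | P e) (e%:R * J)^-1 * J^-1 * K%:R).
  rewrite big_seq_cond [RHS]big_seq_cond; apply: eq_bigr => e /andP[er Pe].
  rewrite -big_mkcondr /= (big_rem e) //= eqxx Pe /= big_seq_cond big1 ?addr0 // => e'.
  by rewrite mem_rem_uniq ?iota_uniq // inE => /and3P[/andP[/negPf ne _] _ /eqP ee']; rewrite ee' eqxx in ne.
by rewrite -!mulr_suml sum_y mul1r mulrC.
Qed.

End Sieve.

(** * Lower bounds for the sieve mass and the totient *)

Section SieveMass.
Variable R : realFieldType.

Lemma sum_inv_sqr (z : nat) : (0 < z)%N ->
  \sum_(1 <= f < z.+1) (f%:R ^+ 2)^-1 <= 2 - z%:R^-1 :> R.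
Proof.
elim: z => // -[|z] IHz _.
  by rewrite big_nat1 expr1n invr1; lra.
rewrite big_nat_recr //=; apply: le_trans (lerD (IHz _) (lexx _)) _ => //.
have z1 : 0 < z.+1%:R :> R by rewrite ltr0n.
rewrite -[z.+2%:R]natr1; set x := z.+1%:R in z1 *.
rewrite -lerBrDr -subr_ge0.
have -> : 2 - (x + 1)^-1 - ((x + 1) ^+ 2)^-1 - (2 - x^-1) = (x * (x + 1) ^+ 2)^-1.
  by field; rewrite !gt_eqF // addr_gt0.
by rewrite invr_ge0 mulr_ge0 ?exprn_ge0 // ?addr_ge0 // ltW.
Qed.

(** Writing [n = e * f ^ 2] with [e] squarefree bounds the sum by the mass times the sum of the
    [1 / f ^ 2], which is below 2. *)
Lemma sieve_mass_ge_coprime (D z : nat) : (0 < z)%N ->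
  \sum_(1 <= n < z.+1 | coprime n D) n%:R^-1 <= 2 * sieve_mass R D z.
Proof.
move=> z_gt0; pose P e := sqfree e && coprime e D.
pose T e f n : R := if n == (e * f ^ 2)%N then (e%:R * f%:R ^+ 2)^-1 else 0.
have T_ge0 e f n : 0 <= T e f n by rewrite /T; case: ifP => // _; rewrite invr_ge0 mulr_ge0 ?exprn_ge0.
apply: (@le_trans _ _ (\sum_(1 <= n < z.+1) \sum_(1 <= e < z.+1 | P e)
  \sum_(1 <= f < z.+1) T e f n)).
  rewrite big_mkcond big_seq [leRHS]big_seq; apply: ler_sum => n.
  rewrite mem_index_iota => /andP[n_gt0 lt_n]; case: ifP => [co_n|_]; last first.
    by apply: sumr_ge0 => e _; apply: sumr_ge0 => f _.
  have [e [f [sf f_gt0 def_n]]] := sqfree_decomp n_gt0.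
  have e_gt0 : (0 < e)%N by case/andP: sf.
  have Pe : P e by rewrite /P sf /=; apply: coprime_dvdl co_n; rewrite def_n dvdn_mulr.
  have le_e : (e < z.+1)%N.
    by apply: leq_ltn_trans lt_n; rewrite def_n leq_pmulr // expn_gt0 f_gt0.
  have le_f : (f < z.+1)%N.
    apply: leq_ltn_trans lt_n; rewrite def_n expnS expn1 mulnA.
    by rewrite leq_pmull // muln_gt0 e_gt0.
  rewrite (big_rem e) ?mem_index_iota ?e_gt0 //= Pe.
  rewrite (big_rem f) ?mem_index_iota ?f_gt0 //=.
  rewrite {1}/T def_n eqxx natrM natrX -addrA lerDl addr_ge0 //.
    by apply: sumr_ge0 => *.
  by apply: sumr_ge0 => *; apply: sumr_ge0 => *.
rewrite exchange_big /= /sieve_mass mulr_sumr -/P.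
rewrite big_seq_cond [leRHS]big_seq_cond; apply: ler_sum => e.
rewrite mem_index_iota => /andP[/andP[e_gt0 _] _].
rewrite exchange_big /=.
apply: (@le_trans _ _ (\sum_(1 <= f < z.+1) (e%:R * f%:R ^+ 2)^-1)).
  apply: ler_sum => f _; rewrite /T -big_mkcond /=.
  have [r_n|r_n] := boolP ((e * f ^ 2)%N \in index_iota 1 z.+1); last first.
    rewrite big_seq_cond big_pred0 ?invr_ge0 ?mulr_ge0 ?exprn_ge0 // => n.
    by apply: contraNF r_n => /andP[nr /eqP<-].
  by rewrite -big_filter filter_pred1_uniq ?iota_uniq // big_seq1.
under eq_bigr do rewrite invfM.
rewrite -mulr_sumr mulrC ler_wpM2r ?invr_ge0 //.
apply: le_trans (sum_inv_sqr z_gt0) _.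
by rewrite lerBlDr lerDl invr_ge0.
Qed.

Lemma sum_coprime_block (D b : nat) : (0 < D)%N ->
  (\sum_((b * D).+1 <= n < (b.+1 * D).+1) coprime n D)%N = totient D.
Proof.
move=> D_gt0; rewrite totient_count_coprime -[(b * D).+1]add0n big_addn.
have -> : ((b.+1 * D).+1 - (b * D).+1 = D)%N by rewrite subSS mulSn addnK.
transitivity (\sum_(0 <= i < D) coprime D i.+1)%N.
  apply: eq_bigr => i _; rewrite coprime_sym -[in LHS]coprime_modr addnS -addSn.
  by rewrite addnC modnMDl coprime_modr.
case: D D_gt0 => // D _.
rewrite big_nat_recr //= [RHS]big_nat_recl //= addnC; congr (_ + _)%N.
by congr nat_of_bool; rewrite -coprime_modr modnn.
Qed.

(** The [j]-th block of [D] consecutive integers, counting from 0, has [totient D] members prime to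
    [D], each with inverse at least [1 / (j.+1 * D)]. *)
Lemma coprime_mass_ge (D b : nat) : (0 < D)%N ->
  (totient D)%:R / D%:R * \sum_(0 <= j < b) j.+1%:R^-1 <=
  \sum_(1 <= n < (b * D).+1 | coprime n D) n%:R^-1 :> R.
Proof.
move=> D_gt0; elim: b => [|b IHb].
  by rewrite (@big_geq _ _ _ 0 0) // mulr0 sumr_ge0 // => n _; rewrite invr_ge0.
rewrite big_nat_recr //= mulrDr.
rewrite [leRHS](@big_cat_nat _ _ _ (b * D).+1) //=; last first.
  by rewrite ?mulSn; lia.
apply: lerD IHb _; rewrite -(sum_coprime_block b D_gt0) natr_sum -mulrA mulr_suml.
rewrite [leRHS]big_mkcond /= big_seq [leRHS]big_seq; apply: ler_sum => n.
rewrite mem_index_iota => /andP[n_gt n_le]; case: ifP => _; last by rewrite mul0r.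
rewrite mul1r -invfM -natrM lef_pV2 ?posrE ?ltr0n ?muln_gt0 ?D_gt0 //.
  by rewrite ler_nat mulnC -ltnS.
exact: leq_ltn_trans n_gt.
Qed.

Lemma harmonic_ge (i : nat) : i%:R / 2 <= \sum_(0 <= j < 2 ^ i) j.+1%:R^-1 :> R.
Proof.
elim: i => [|i IHi]; first by rewrite mul0r sumr_ge0 // => j _; rewrite invr_ge0.
rewrite (@big_cat_nat _ _ _ (2 ^ i)) //=; last by rewrite leq_exp2l.
rewrite -natr1 mulrDl; apply: lerD IHi _.
apply: (@le_trans _ _ (\sum_(2 ^ i <= j < 2 ^ i.+1) (2 ^ i.+1)%:R^-1)).
  have i2 : (2 ^ i)%:R != 0 :> R by rewrite pnatr_eq0 expn_eq0.
  rewrite sumr_const_nat.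
  have -> : (2 ^ i.+1 - 2 ^ i = 2 ^ i)%N by rewrite expnS mul2n -addnn addnK.
  by rewrite -[leRHS]mulr_natr expnS natrM invfM -mulrA mulVf // mulr1 mul1r.
rewrite big_seq [leRHS]big_seq; apply: ler_sum => j; rewrite mem_index_iota => /andP[_ lt_j].
by rewrite lef_pV2 ?posrE ?ltr0n ?expn_gt0 // ler_nat.
Qed.

(** Here [i] plays the part of [ln (z / D)]. The factor [totient D / D] matters: a progression of
    difference [D] has about [H / D] terms in a window of length [H], so [D] cancels and the sieve
    saves a factor [totient D]. *)
Lemma sieve_mass_ge (D i z : nat) : (0 < D)%N -> (2 ^ i * D <= z)%N ->
  (totient D)%:R * i%:R / (4 * D%:R) <= sieve_mass R D z.
Proof.
move=> D_gt0 le_z; have z_gt0 : (0 < z)%N.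
  by apply: leq_trans le_z; rewrite muln_gt0 expn_gt0.
rewrite -(ler_pM2l (ltr0n R 2 : 0 < 2)).
apply: le_trans (sieve_mass_ge_coprime D z_gt0).
have le1 : \sum_(1 <= n < (2 ^ i * D).+1 | coprime n D) n%:R^-1 <=
    \sum_(1 <= n < z.+1 | coprime n D) n%:R^-1 :> R.
  rewrite [leRHS](@big_cat_nat _ _ _ (2 ^ i * D).+1) //= lerDl.
  by rewrite sumr_ge0 // => n _; rewrite invr_ge0.
apply: le_trans le1; apply: le_trans (coprime_mass_ge (2 ^ i) D_gt0).
have -> : 2 * ((totient D)%:R * i%:R / (4 * D%:R)) = (totient D)%:R / D%:R * (i%:R / 2) :> R.
  by field; rewrite pnatr_eq0 -lt0n.
by rewrite ler_wpM2l ?harmonic_ge // divr_ge0.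
Qed.

End SieveMass.

(** Prime by prime, [p ^ e] is at most the square of [p.-1 * p ^ e.-1], except that [p = 2] costs a
    factor 2. This turns a bound on the totient of a modulus into one on the modulus. *)
Lemma leq_totient_sqr n : (0 < n)%N -> (n <= 2 * totient n ^ 2)%N.
Proof.
move=> n_gt0; rewrite totientE // -{1}(prod_primes n_gt0).
have pr_s p : p \in primes n -> prime p by rewrite mem_primes => /andP[].
have lg p : p \in primes n -> (0 < logn p n)%N by rewrite logn_gt0.
have key p e : prime p -> (0 < e)%N ->
  (p ^ e <= (if p == 2 then 2 else 1) * (p.-1 * p ^ e.-1) ^ 2)%N.
  move=> p_pr; case: e => // e _ /=; have p_gt1 := prime_gt1 p_pr.
  have pe : (0 < p ^ e)%N by rewrite expn_gt0 ltnW.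
  rewrite expnS; case: eqP => [->|/eqP p2] /=.
    by rewrite mul1n leq_mul2l /= -mulnn leq_pmulr // expn_gt0.
  have p_gt2 : (2 < p)%N by rewrite ltn_neqAle eq_sym p2.
  rewrite mul1n expnMn; apply: leq_mul; last by rewrite -mulnn leq_pmulr.
  by case: p p_gt2 {p_pr p_gt1 p2 pe} => // p; rewrite /=; nia.
apply: (@leq_trans (\prod_(p <- primes n)
    ((if p == 2 then 2 else 1) * (p.-1 * p ^ (logn p n).-1) ^ 2)))%N.
  rewrite big_seq [leqRHS]big_seq; apply: leq_prod => p ps.
  by apply: key; [exact: pr_s | exact: lg].
rewrite big_split /=; apply: leq_mul; last first.
  by rewrite expnS expn1 -big_split; under eq_bigr do rewrite -mulnn.
rewrite -big_mkcond /= -big_filter.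
have [p2|p2] := boolP (2 \in primes n).
  by rewrite filter_pred1_uniq ?primes_uniq // big_seq1.
rewrite big_seq_cond big_pred0 // => p.
by rewrite mem_filter andbT; apply: contraNF p2 => /andP[/eqP->].
Qed.

(** * Landau's function just after a superchampion *)

Lemma ln_diff_le (R : realType) (x y : R) : 0 < x -> 0 < y -> ln y - ln x <= (y - x) / x.
Proof.
move=> x0 y0; rewrite -ln_div ?posrE //.
have -> : y / x = 1 + (y - x) / x by field; rewrite gt_eqF.
apply: le_ln1Dx; rewrite mulrBl mulfV ?gt_eqF // ltrBrDl subrr divr_gt0 //.
Qed.

Lemma logn_prod_exp (b : nat -> nat) B q :
  (forall p, (0 < b p)%N -> prime p) ->
  logn q (\prod_(0 <= p < B) p ^ b p) = if (q < B)%N then b q else 0%N.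
Proof.
move=> b_pr; elim: B => [|B IHB]; first by rewrite big_geq // logn1.
have pos p : (0 < p ^ b p)%N.
  by have [->|/b_pr/prime_gt0 p0] := posnP (b p); rewrite // expn_gt0 p0.
rewrite big_nat_recr //= lognM // ?prodn_gt0 // IHB lognX.
have [bB0|/[dup] bB0 /b_pr B_pr] := posnP (b B).
  rewrite bB0 mul0n addn0 ltnS; case: ltngtP => // ->; by rewrite bB0.
rewrite ltnS; case: (ltngtP q B) => [lt|gt|->].
- by rewrite logn_prime // (ltn_eqF lt) muln0 addn0.
- by rewrite logn_prime // (gtn_eqF gt) muln0.
- by rewrite logn_prime // eqxx muln1.
Qed.

Lemma ln_prod_exp (R : realType) (b : nat -> nat) B :
  (forall p, (0 < b p)%N -> prime p) ->
  ln (\prod_(0 <= p < B) p ^ b p)%N%:R = \sum_(0 <= p < B) (b p)%:R * ln p%:R :> R.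
Proof.
move=> b_pr; elim: B => [|B IHB]; first by rewrite !big_geq // ln1.
have pos p : (0 < p ^ b p)%N.
  by have [->|/b_pr/prime_gt0 p0] := posnP (b p); rewrite // expn_gt0 p0.
rewrite !big_nat_recr //= natrM lnM ?posrE ?ltr0n ?prodn_gt0 // IHB; congr (_ + _).
have [->|/b_pr/prime_gt0 B0] := posnP (b B); first by rewrite expn0 ln1 mul0r.
by rewrite natrX lnXn ?ltr0n // mulr_natl.
Qed.

Lemma prod_logn M B : (0 < M < B)%N -> (\prod_(0 <= p < B) p ^ logn p M)%N = M.
Proof.
case/andP=> M_gt0 lt_MB; apply: eqn_from_log => //.
  by apply: prodn_gt0 => p; case: p => [|p]; rewrite ?logn0 ?expn_gt0.
move=> p; rewrite logn_prod_exp => [|q]; last by rewrite logn_gt0 mem_primes => /andP[].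
case: ltnP => // le_Bp; apply/esym/eqP; rewrite -leqn0 leqNgt logn_gt0 mem_primes.
apply/negP => /and3P[_ _ /dvdn_leq]; rewrite M_gt0 => /(_ isT).
by rewrite leqNgt (leq_trans lt_MB).
Qed.

(** The tangents at [x] and at [y] bound the logarithm from both sides; the two bounds differ by
    [(y - x) ^ 2 / (x * y)], and [y >= x / 2]. *)
Lemma ln_quadratic (R : realType) (x y : R) : 0 < x -> `|y - x| <= x / 2 ->
  `|ln y - ln x - (y - x) / x| <= 2 * (y - x) ^+ 2 / x ^+ 2.
Proof.
move=> x0; rewrite ler_norml => /andP[ge_y le_y].
have y0 : 0 < y by lra.
have up := ln_diff_le x0 y0; have := ln_diff_le y0 x0.
have -> : (x - y) / y = - ((y - x) / x) + (y - x) ^+ 2 / (x * y).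
  by field; rewrite !gt_eqF.
have le2 : (y - x) ^+ 2 / (x * y) <= 2 * (y - x) ^+ 2 / x ^+ 2.
  have -> : 2 * (y - x) ^+ 2 / x ^+ 2 = (y - x) ^+ 2 / (x * (x / 2)).
    by field; rewrite gt_eqF.
  rewrite ler_wpM2l ?sqr_ge0 // lef_pV2 ?posrE ?mulr_gt0 ?ler_pM2l //; lra.
have ge0 : 0 <= 2 * (y - x) ^+ 2 / x ^+ 2 by rewrite divr_ge0 ?sqr_ge0 // mulr_ge0 ?sqr_ge0.
by move=> low; rewrite ler_norml; apply/andP; split; lra.
Qed.

Section Superchampion.
Variables (R : realType) (P m : nat).
Let l : R := ln P%:R.
Let rho : R := P%:R / l.

Definition weight (p j : nat) : nat := (0 < j) * p ^ j.
Definition weight_step (p j : nat) : nat := p ^ j.+1 - (0 < j) * p ^ j.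
Definition cost_step (p j : nat) : R := (weight_step p j)%:R - rho * ln p%:R.
(** The part of [ell M - rho * ln M] due to the factor [p ^ j]. Maximising [M / exp (ell M / rho)]
    means minimising this difference, which can be done one prime at a time. *)
Definition cost (p j : nat) : R := (weight p j)%:R - rho * (j%:R * ln p%:R).

Lemma costS p j : (0 < p)%N -> cost p j.+1 = cost p j + cost_step p j.
Proof.
move=> p_gt0; rewrite /cost /cost_step /weight_step natrB; last first.
  by case: j => [|j]; rewrite ?mul0n // mul1n leq_pexp2l.
by rewrite /weight mul1n -(natr1 j); ring.
Qed.

(** This is the convexity of [weight p]. The step out of 0 is [p], not [p - 1], and it stays below
    the next one because [p ^ 2 - p >= p]. *)
Lemma weight_step_leq p i j : (1 < p)%N -> (i <= j)%N ->
  (weight_step p i <= weight_step p j)%N.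
Proof.
move=> p_gt1; elim: j => [|j IHj]; first by rewrite leqn0 => /eqP->.
rewrite leq_eqVlt => /predU1P[->//|/IHj /leq_trans]; apply.
rewrite /weight_step; case: j {IHj} => [|j]; rewrite ?mul0n ?mul1n ?subn0.
  by rewrite expn1 !expnS expn0; nia.
by rewrite [(p ^ j.+3)%N]expnS [(p ^ j.+2)%N]expnS; nia.
Qed.

Lemma cost_step_le p i j : (1 < p)%N -> (i <= j)%N -> cost_step p i <= cost_step p j.
Proof. by move=> p_gt1 le_ij; rewrite lerD2r ler_nat weight_step_leq. Qed.

Lemma champ_exp_exists p : exists j, prime p ==> (0 < cost_step p j).
Proof.
case: (boolP (prime p)) => [p_pr|_]; last by exists 0%N.
have p_gt1 := prime_gt1 p_pr; set x := rho * ln p%:R.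
exists (Num.truncn x).+1; rewrite /= /cost_step -/x subr_gt0.
apply: lt_le_trans (truncnS_gt x) _; rewrite ler_nat /weight_step mul1n.
move: (Num.truncn x).+1 => n; rewrite expnS -{2}[(p ^ n)%N]mul1n -mulnBl.
apply: leq_trans (ltnW (ltn_expl n p_gt1)) _.
by rewrite leq_pmull // subn_gt0.
Qed.

(* The exponent of [p] in the maximiser of [M / exp (ell M / rho)], with [rho = P / ln P]. *)
Definition champ_exp (p : nat) : nat := ex_minn (champ_exp_exists p).

Lemma champ_exp_nonprime p : ~~ prime p -> champ_exp p = 0%N.
Proof.
rewrite /champ_exp; case: ex_minnP => j _ min_j p_npr; apply/eqP; rewrite -leqn0.
by apply: min_j; rewrite (negPf p_npr).
Qed.

Lemma champ_exp_gt0_prime p : (0 < champ_exp p)%N -> prime p.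
Proof. by move=> a0; apply: contraLR a0 => /champ_exp_nonprime ->. Qed.

Lemma cost_step_gt0 p j : prime p -> (champ_exp p <= j)%N -> 0 < cost_step p j.
Proof.
rewrite /champ_exp; case: ex_minnP => i Pi _ p_pr le_ij; rewrite p_pr /= in Pi.
exact: lt_le_trans (cost_step_le (prime_gt1 p_pr) le_ij).
Qed.

Lemma cost_step_le0 p j : (j < champ_exp p)%N -> cost_step p j <= 0.
Proof.
rewrite /champ_exp; case: ex_minnP => i _ min_i lt_ji; rewrite leNgt; apply/negP => c0.
by have := min_i j; rewrite c0 implybT => /(_ isT); rewrite leqNgt lt_ji.
Qed.

Lemma cost_up p i j : prime p -> (champ_exp p <= i)%N -> (i < j)%N ->
  cost_step p i <= cost p j - cost p i.
Proof.
move=> p_pr le_i; elim: j => // j IHj; rewrite ltnS leq_eqVlt costS ?prime_gt0 //.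
case/predU1P=> [->|lt_ij]; first by rewrite addrAC subrr add0r.
have := IHj lt_ij; have := cost_step_gt0 p_pr (leq_trans le_i (ltnW lt_ij)); lra.
Qed.

Lemma cost_down p i j : (i < champ_exp p)%N -> (j <= i)%N ->
  - cost_step p i <= cost p j - cost p i.+1.
Proof.
move=> lt_i; have p_gt0 : (0 < p)%N.
  by apply/prime_gt0/champ_exp_gt0_prime; apply: leq_ltn_trans lt_i.
elim: i lt_i => [|i IHi] lt_i.
  by rewrite leqn0 costS // => /eqP->; lra.
rewrite leq_eqVlt costS // => /predU1P[->|lt_ij]; first lra.
by have := IHi (ltnW lt_i) lt_ij; have := cost_step_le0 (ltnW lt_i); lra.
Qed.

Lemma cost_alpha_ge0 p j : prime p -> 0 <= cost p j - cost p (champ_exp p).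
Proof.
move=> p_pr; case: (ltngtP j (champ_exp p)) => [lt_j|gt_j|->]; last by rewrite subrr.
  case def_a: (champ_exp p) lt_j => [|a] // lt_j.
  have lt_a : (a < champ_exp p)%N by rewrite def_a.
  by apply: le_trans (cost_down lt_a lt_j); rewrite oppr_ge0 cost_step_le0.
by apply: le_trans (cost_up p_pr (leqnn _) gt_j); rewrite ltW ?cost_step_gt0.
Qed.

Hypotheses (P_prime : prime P) (l_ge8 : 8 <= l) (l_small : 16 * l ^+ 2 <= P%:R).
Hypotheses (m_small : (64 * m ^ 2 < P)%N).

Let P_gt0 : 0 < P%:R :> R. Proof. by rewrite ltr0n prime_gt0. Qed.
Let l_gt0 : 0 < l. Proof. exact: lt_le_trans l_ge8. Qed.
Let rho_gt0 : 0 < rho. Proof. exact: divr_gt0. Qed.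
Let rhol : rho * l = P%:R. Proof. by rewrite /rho mulfVK // gt_eqF. Qed.

Lemma cost_step0E p : cost_step p 0 = p%:R - rho * ln p%:R.
Proof. by rewrite /cost_step /weight_step mul0n subn0 expn1. Qed.

Lemma cost_step0_right p : (P <= p)%N -> (p%:R - P%:R) / 2 <= cost_step p 0.
Proof.
move=> le_Pp; have p0 : 0 < p%:R :> R by apply: lt_le_trans P_gt0 _; rewrite ler_nat.
have le_PpR : P%:R <= p%:R :> R by rewrite ler_nat.
rewrite cost_step0E; have /(ler_wpM2l (ltW rho_gt0)) := ln_diff_le P_gt0 p0.
rewrite mulrBr rhol -/l.
have -> : rho * ((p%:R - P%:R) / P%:R) = (p%:R - P%:R) / l.
  by rewrite /rho; field; rewrite !gt_eqF.
have : (p%:R - P%:R) / l <= (p%:R - P%:R) / 2.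
  rewrite ler_wpM2l ?subr_ge0 // lef_pV2 ?posrE //.
  by apply: le_trans l_ge8; rewrite ler_nat.
lra.
Qed.

(** The slope of [x - rho * ln x] is [1 - rho / x]. For [x >= P / 4] one has [rho / x <= 4 / l], so
    [l >= 8] keeps the slope at least one half. *)
Lemma cost_step0_left p : (p <= P)%N -> (P <= 4 * p)%N ->
  (P%:R - p%:R) / 2 <= - cost_step p 0.
Proof.
move=> le_pP le_P4p; have p0 : 0 < p%:R :> R.
  by rewrite ltr0n; move: (prime_gt0 P_prime) le_P4p; case: (p) => //; lia.
have le_PpR : p%:R <= P%:R :> R by rewrite ler_nat.
have le_P4pR : P%:R <= 4 * p%:R :> R by rewrite -natrM ler_nat.
rewrite cost_step0E; have /(ler_wpM2l (ltW rho_gt0)) := ln_diff_le p0 P_gt0.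
rewrite mulrBr -/l rhol.
have le_half : rho * ((P%:R - p%:R) / p%:R) <= (P%:R - p%:R) / 2.
  rewrite mulrCA ler_wpM2l ?subr_ge0 // /rho.
  rewrite ler_pdivrMr // ler_pdivrMr //.
  have : 0 <= (l - 8) * p%:R by rewrite mulr_ge0 ?subr_ge0 // ltW.
  lra.
lra.
Qed.

Lemma ln2_ge_half : 1 / 2 <= ln 2 :> R.
Proof.
have : ln (1 + (- (1 / 2))) <= - (1 / 2) :> R by apply: le_ln1Dx; lra.
have -> : 1 + - (1 / 2) = 2^-1 :> R by lra.
by rewrite lnV ?posrE //; lra.
Qed.

(** If [p ^ 2 >= P], then [rho * ln p >= P / 2], which dominates [p + m]. Otherwise [p] and [m] are
    of order at most [sqrt P], and [16 * l ^ 2 <= P] makes [rho] at least [4 * p] and [32 * m]. *)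
Lemma cost_step0_far p : (1 < p)%N -> (4 * p < P)%N -> cost_step p 0 < - m%:R.
Proof.
move=> p_gt1 lt_4pP; rewrite cost_step0E.
have p0 : 0 < p%:R :> R by rewrite ltr0n ltnW.
have lt_4pPR : 4 * p%:R < P%:R :> R by rewrite -natrM ltr_nat.
have mP : 64 * m%:R ^+ 2 < P%:R :> R by rewrite -natrX -natrM ltr_nat.
have m0 : 0 <= m%:R :> R by rewrite ler0n.
have [le_Pp2|lt_p2P] := leqP P (p ^ 2).
  have le_l : l <= 2 * ln p%:R.
    rewrite -[2]/(1 *+ 2) mulr_natl -lnXn // ler_ln ?posrE ?exprn_gt0 //.
    by rewrite -natrX ler_nat.
  have Pp2 : P%:R <= p%:R ^+ 2 :> R by rewrite -natrX ler_nat.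
  have : rho * l <= rho * (2 * ln p%:R) by rewrite ler_pM2l.
  rewrite rhol => le1; have : m%:R < p%:R :> R by nra.
  lra.
have lt_p2 : p%:R ^+ 2 < P%:R :> R by rewrite -natrX ltr_nat.
have ln_p : 1 / 2 <= ln p%:R :> R.
  by apply: le_trans ln2_ge_half _; rewrite ler_ln ?posrE // ler_nat.
have le1 : rho * (1 / 2) <= rho * ln p%:R by rewrite ler_pM2l.
have rho_p : 4 * p%:R <= rho.
  rewrite /rho ler_pdivlMr // -ler_sqr ?nnegrE ?mulr_ge0 ?(ltW l_gt0) ?(ltW P_gt0) ?(ltW p0) //.
  have := ler_pM (mulr_ge0 (ler0n R 16) (sqr_ge0 l)) (sqr_ge0 _) l_small (ltW lt_p2).
  have -> : (4 * p%:R * l) ^+ 2 = 16 * l ^+ 2 * p%:R ^+ 2 by ring.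
  by move=> le2; apply: le_trans le2 _; rewrite -expr2.
have rho_m : 32 * m%:R <= rho.
  rewrite /rho ler_pdivlMr // -ler_sqr ?nnegrE ?mulr_ge0 ?(ltW l_gt0) ?(ltW P_gt0) ?(ltW p0) //.
  have := ler_pM (mulr_ge0 (ler0n R 16) (sqr_ge0 l))
    (mulr_ge0 (ler0n R 64) (sqr_ge0 _)) l_small (ltW mP).
  have -> : (32 * m%:R * l) ^+ 2 = 16 * l ^+ 2 * (64 * m%:R ^+ 2) by ring.
  by move=> le2; apply: le_trans le2 _; rewrite -expr2.
have : 1 < p%:R :> R by rewrite ltr1n.
lra.
Qed.

Lemma cost_step0_near p : prime p -> `|cost_step p 0| <= m%:R ->
  `|p%:R - P%:R| <= 2 * `|cost_step p 0|.
Proof.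
move=> p_pr le_m; have [le_Pp|lt_pP] := leqP P p.
  have le1 := cost_step0_right le_Pp; have := ler_norm (cost_step p 0).
  by rewrite [`|p%:R - _|]ger0_norm ?subr_ge0 ?ler_nat //; lra.
have [le_P4p|lt_4pP] := leqP P (4 * p).
  have le1 := cost_step0_left (ltnW lt_pP) le_P4p; have := ler_norm (- cost_step p 0).
  by rewrite normrN [`|p%:R - _|]ler0_norm ?subr_le0 ?ler_nat ?(ltnW lt_pP) //; lra.
have := cost_step0_far (prime_gt1 p_pr) lt_4pP.
by have := ler_norm (- cost_step p 0); rewrite normrN; lra.
Qed.

Lemma champ_exp_right p : (P < p)%N -> champ_exp p = 0%N.
Proof.
move=> lt_Pp; case: (boolP (prime p)) => [p_pr|/champ_exp_nonprime//].
apply/eqP; rewrite -leqn0 leqNgt; apply/negP => /cost_step_le0.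
have := cost_step0_right (ltnW lt_Pp).
have : P%:R < p%:R :> R by rewrite ltr_nat.
lra.
Qed.

(** The second step [p ^ 2 - p] is far above [rho * ln p <= P], while the first has cost at most 0.
    For [p = P] that cost is exactly 0: the strict inequality defining [champ_exp] is what puts [P]
    into the champion. *)
Lemma champ_exp_left p : prime p -> (p <= P)%N -> (P <= 4 * p)%N -> champ_exp p = 1%N.
Proof.
move=> p_pr le_pP le_P4p; apply/eqP; rewrite eqn_leq; apply/andP; split.
  rewrite leqNgt; apply/negP => /cost_step_le0; apply/negP; rewrite -ltNge.
  have P_large : 128 <= P%:R :> R.
    have := l_small; have : 8 ^+ 2 <= l ^+ 2.
      by rewrite ler_sqr ?nnegrE ?(ltW l_gt0).
    lra.
  have le_P4pR : P%:R <= 4 * p%:R :> R by rewrite -natrM ler_nat.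
  have le_pPR : p%:R <= P%:R :> R by rewrite ler_nat.
  have p0 : 0 < p%:R :> R by rewrite ltr0n prime_gt0.
  have : rho * ln p%:R <= rho * l by rewrite ler_pM2l // ler_ln ?posrE.
  rewrite rhol /cost_step /weight_step mul1n expn1 natrB ?leq_pexp2l ?prime_gt0 //.
    rewrite natrX; nra.
  by rewrite -{1}[p]expn1 leq_pexp2l ?prime_gt0.
rewrite lt0n; apply/eqP => a0; have := @cost_step_gt0 p 0 p_pr.
rewrite a0 => /(_ isT); have := cost_step0_left le_pP le_P4p.
have : p%:R <= P%:R :> R by rewrite ler_nat.
lra.
Qed.

Definition champion : nat := \prod_(0 <= p < P.+1) p ^ champ_exp p.

Lemma logn_champion p : logn p champion = champ_exp p.
Proof.
rewrite logn_prod_exp; last exact: champ_exp_gt0_prime.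
by case: ltnP => // /champ_exp_right.
Qed.

Lemma champion_gt0 : (0 < champion)%N.
Proof.
apply: prodn_gt0 => p; have [->|/champ_exp_gt0_prime/prime_gt0 p0] := posnP (champ_exp p) => //.
by rewrite expn_gt0 p0.
Qed.

Hypothesis steps_large : forall p j, prime p -> (0 < j)%N -> m%:R < `|cost_step p j|.

(** By convexity a move costs at least each single step it crosses. Steps of index at least 1 cost
    more than [m], so the only cheap moves insert or remove one prime, and such a prime lies within
    [2 * c] of [P]. *)
Lemma near_exponent p j : prime p -> cost p j - cost p (champ_exp p) <= m%:R ->
  let e := j%:R - (champ_exp p)%:R : R in let c := cost p j - cost p (champ_exp p) in
  [/\ (weight p j)%:R - (weight p (champ_exp p))%:R = e * p%:R,
      `|e * (p%:R - P%:R)| <= 2 * c &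
      `|e * (ln p%:R - l) - e * (p%:R - P%:R) / P%:R| <= 8 * m%:R * c / P%:R ^+ 2].
Proof.
move=> p_pr le_m e c; have p_gt0 := prime_gt0 p_pr.
have m0 : 0 <= m%:R :> R by rewrite ler0n.
have mP : 64 * m%:R ^+ 2 < P%:R :> R by rewrite -natrX -natrM ltr_nat.
have m4P : 4 * m%:R <= P%:R :> R.
  case: m mP => [|k]; first by rewrite mulr0 ltW.
  by have : 1 <= k.+1%:R :> R; [rewrite ler1n | nra].
have key : c = `|cost_step p 0| -> `|e| = 1 ->
    `|e * (p%:R - P%:R)| <= 2 * c /\
    `|e * (ln p%:R - l) - e * (p%:R - P%:R) / P%:R| <= 8 * m%:R * c / P%:R ^+ 2.
  move=> cE e1; have le_c : c <= m%:R by [].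
  have d_le : `|p%:R - P%:R| <= 2 * c by rewrite cE cost_step0_near // -cE.
  split; first by rewrite normrM e1 mul1r.
  rewrite -mulrA -mulrBr normrM e1 mul1r.
  apply: le_trans (ln_quadratic P_gt0 _) _; first by lra.
  rewrite ler_wpM2r ?invr_ge0 ?sqr_ge0 //.
  (* One factor of [(p - P) ^ 2] is bounded by [2 * c], the other by [2 * m]: keeping a factor [c]
     makes the errors summable over the primes. *)
  rewrite -real_normK ?num_real // expr2.
  have := ler_pM (normr_ge0 _) (normr_ge0 _) d_le (le_trans d_le (ler_wpM2l (ler0n _ 2) le_c)).
  lra.
case: (ltngtP j (champ_exp p)) => [lt_j|gt_j|eq_j]; last first.
- have e0 : e = 0 by rewrite /e eq_j subrr.
  have c0 : c = 0 by rewrite /c eq_j subrr.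
  by rewrite e0 c0 eq_j !mul0r !mulr0 mul0r !subrr normr0; split.
- have c_ge := cost_up p_pr (leqnn _) gt_j.
  have s_gt0 := cost_step_gt0 p_pr (leqnn _).
  have a0 : champ_exp p = 0%N.
    apply/eqP; rewrite -leqn0 leqNgt; apply/negP => /(steps_large p_pr).
    by rewrite gtr0_norm // ltNge (le_trans c_ge).
  have j1 : j = 1%N.
    apply/eqP; rewrite eqn_leq -{2}a0 gt_j andbT leqNgt; apply/negP => gt1.
    have s1_gt0 : 0 < cost_step p 1 by apply: cost_step_gt0; rewrite ?a0.
    have := @cost_up p 1 j p_pr _ gt1; rewrite a0 => /(_ isT) c1.
    have := steps_large p_pr (ltn0Sn 0); rewrite gtr0_norm //.
    move: le_m; rewrite -/c => le_m; move: s_gt0 c1; rewrite a0 costS // /c a0 in le_m *.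
    lra.
  have e1 : e = 1 by rewrite /e a0 j1 subr0.
  have cE : c = `|cost_step p 0|.
    by rewrite gtr0_norm -?a0 // /c j1 a0 costS // addrAC subrr add0r.
  have [|k1 k2] := key cE; first by rewrite e1 normr1.
  by split=> //; rewrite e1 j1 a0 /weight mul1n mul0n expn1 subr0 mul1r.
case def_a: (champ_exp p) lt_j => [|a] // lt_j.
have lt_a : (a < champ_exp p)%N by rewrite def_a.
have s_le0 := cost_step_le0 lt_a.
have c_ge := cost_down lt_a lt_j.
have a0 : a = 0%N.
  apply/eqP; rewrite -leqn0 leqNgt; apply/negP => /(steps_large p_pr).
  by rewrite ler0_norm // ltNge (le_trans c_ge) // -def_a.
have j0 : j = 0%N by move: lt_j; rewrite a0; case: (j).
have e1 : e = -1 by rewrite /e def_a a0 j0 sub0r.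
have cE : c = `|cost_step p 0|.
  by rewrite ler0_norm -?a0 // /c j0 def_a a0 costS // opprD addrA subrr sub0r.
have [|k1 k2] := key cE; first by rewrite e1 normrN1.
by split=> //; rewrite e1 j0 a0 /weight mul1n mul0n expn1 sub0r mulN1r.
Qed.

(** As [ell] grows by at most [m] and [ln] does not decrease, the costs of all changes of exponent
    add up to at most [m]. Hence the quadratic errors total at most [8 * m ^ 2 / P ^ 2]. *)
Lemma champion_log_estimate M : (champion <= M)%N -> (ell M <= ell champion + m)%N ->
  `|ln (M%:R : R) - ln champion%:R - ((ell M)%:R - (ell champion)%:R) / P%:R| <=
  8 * m%:R ^+ 2 / P%:R ^+ 2.
Proof.
move=> le_NM le_ell; have N_gt0 := champion_gt0; have M_gt0 := leq_trans N_gt0 le_NM.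
pose B := M.+1; pose b p := logn p M.
have ltNB : (0 < champion < B)%N by rewrite N_gt0 ltnS.
have ltMB : (0 < M < B)%N by rewrite M_gt0 ltnS /=.
have logn_prime n p : (0 < logn p n)%N -> prime p by rewrite logn_gt0 mem_primes => /andP[].
pose c p := cost p (b p) - cost p (champ_exp p).
pose e p : R := (b p)%:R - (champ_exp p)%:R.
pose d p : R := p%:R - P%:R.
have ellM : (ell M)%:R = \sum_(0 <= p < B) (weight p (b p))%:R :> R.
  by rewrite (@ell_widen M B) // natr_sum.
have ellN : (ell champion)%:R = \sum_(0 <= p < B) (weight p (champ_exp p))%:R :> R.
  rewrite (@ell_widen champion B) ?ltnS // natr_sum.
  by apply: eq_bigr => p _; rewrite logn_champion.
have lnM : ln M%:R = \sum_(0 <= p < B) (b p)%:R * ln p%:R :> R.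
  by rewrite -[in LHS](prod_logn ltMB) ln_prod_exp //; apply: logn_prime.
have lnN : ln champion%:R = \sum_(0 <= p < B) (champ_exp p)%:R * ln p%:R :> R.
  rewrite -[in LHS](prod_logn ltNB) ln_prod_exp; last exact: logn_prime.
  by apply: eq_bigr => p _; rewrite logn_champion.
have npr0 p : ~~ prime p -> b p = 0%N /\ champ_exp p = 0%N.
  move=> p_npr; split; last exact: champ_exp_nonprime.
  by apply/eqP; rewrite -leqn0 leqNgt; apply: contra p_npr => /logn_prime.
have c_ge0 p : 0 <= c p.
  case: (boolP (prime p)) => [p_pr|/npr0[b0 a0]]; first exact: cost_alpha_ge0.
  by rewrite /c b0 a0 subrr.
have le_lnNM : ln champion%:R <= ln M%:R :> R by rewrite ler_ln ?posrE ?ltr0n // ler_nat.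
have le_ellR : (ell M)%:R - (ell champion)%:R <= m%:R :> R.
  by rewrite lerBlDl -natrD ler_nat.
have sum_c : \sum_(0 <= p < B) c p <= m%:R.
  have -> : \sum_(0 <= p < B) c p =
      ((ell M)%:R - (ell champion)%:R) - rho * (ln M%:R - ln champion%:R).
    rewrite ellM ellN lnM lnN -!sumrB mulr_sumr -sumrB; apply: eq_bigr => p _.
    by rewrite /c /cost; ring.
  apply: le_trans le_ellR; rewrite lerBlDr lerDl mulr_ge0 ?subr_ge0 //.
  exact: ltW.
have c_le p : p \in index_iota 0 B -> c p <= m%:R.
  move=> pB; apply: le_trans sum_c; rewrite (big_rem p) //= lerDl.
  by apply: sumr_ge0.
have facts p : p \in index_iota 0 B ->
   [/\ (weight p (b p))%:R - (weight p (champ_exp p))%:R = e p * p%:R,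
      `|e p * d p| <= 2 * c p &
      `|e p * (ln p%:R - l) - e p * d p / P%:R| <= 8 * m%:R * c p / P%:R ^+ 2].
  move=> /c_le c_le_p; case: (boolP (prime p)) => [p_pr|/npr0[b0 a0]].
    exact: near_exponent.
  have -> : c p = 0 by rewrite /c b0 a0 subrr.
  have -> : e p = 0 by rewrite /e b0 a0 subrr.
  by rewrite b0 a0 !mul0r !mulr0 mul0r !subrr normr0.
pose A : int := \sum_(0 <= p < B) ((b p)%:Z - (champ_exp p)%:Z).
have AE : A%:~R = \sum_(0 <= p < B) e p :> R.
  rewrite rmorph_sum /=; apply: eq_bigr => p _.
  by rewrite rmorphB /= -!pmulrn.
pose X := \sum_(0 <= p < B) e p * d p.
pose Y := \sum_(0 <= p < B) e p * (ln p%:R - l).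
have dell : (ell M)%:R - (ell champion)%:R = A%:~R * P%:R + X.
  rewrite ellM ellN -sumrB AE mulr_suml -big_split /=.
  rewrite big_seq [RHS]big_seq; apply: eq_bigr => p /facts[-> _ _].
  by rewrite /d; ring.
have dln : ln M%:R - ln champion%:R = A%:~R * l + Y.
  rewrite lnM lnN -sumrB AE mulr_suml -big_split /=.
  by apply: eq_bigr => p _; rewrite /e; ring.
have X_le : `|X| <= 2 * m%:R.
  apply: le_trans (ler_norm_sum _ _ _) _.
  apply: (@le_trans _ _ (\sum_(0 <= p < B) 2 * c p)).
    by rewrite big_seq [leRHS]big_seq; apply: ler_sum => p /facts[].
  by rewrite -mulr_sumr ler_wpM2l.
have XY_le : `|Y - X / P%:R| <= 8 * m%:R ^+ 2 / P%:R ^+ 2.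
  rewrite /X /Y mulr_suml -sumrB; apply: le_trans (ler_norm_sum _ _ _) _.
  apply: (@le_trans _ _ (\sum_(0 <= p < B) 8 * m%:R * c p / P%:R ^+ 2)).
    by rewrite big_seq [leRHS]big_seq; apply: ler_sum => p /facts[].
  rewrite -mulr_suml -mulr_sumr ler_wpM2r ?invr_ge0 ?sqr_ge0 //.
  by rewrite expr2 mulrA ler_wpM2l // mulr_ge0.
have mP : 64 * m%:R ^+ 2 < P%:R :> R by rewrite -natrX -natrM ltr_nat.
have m0 : 0 <= m%:R :> R by rewrite ler0n.
have m4P : 4 * m%:R <= P%:R :> R.
  case: (m) mP => [|k]; first by rewrite mulr0 ltW.
  by have : 1 <= k.+1%:R :> R; [rewrite ler1n | nra].
have P1 : 1 <= P%:R :> R by rewrite ler1n prime_gt0.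
have XP_le : `|X / P%:R| <= 1.
  by rewrite normrM normfV (gtr0_norm P_gt0) ler_pdivrMr //; lra.
have err_le : 8 * m%:R ^+ 2 / P%:R ^+ 2 <= 1 :> R.
  rewrite ler_pdivrMr ?exprn_gt0 // mul1r expr2; nra.
(* [A] is the number of primes gained minus the number lost. If it were positive, [ell] would grow
   by at least [P - 2 * m > m]; if negative, [ln] would fall, since [l >= 8] outweighs [Y <= 2]. *)
have A0 : A = 0.
  apply/eqP; rewrite eq_le -ltzD1 -[0 <= A]ltzD1 add0r; apply/andP; split.
    rewrite -(ltr_int R) -(ltr_pM2r P_gt0) mul1r.
    by move: X_le; rewrite ler_norml => /andP[]; lra.
  rewrite -(ltr_int R) rmorphD /= -(ltr_pM2r l_gt0) mul0r mulrDl mul1r.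
  move: XY_le XP_le; rewrite !ler_norml => /andP[? ?] /andP[? ?].
  have Y2 : Y <= 2 by lra.
  have AY : 0 <= A%:~R * l + Y by rewrite -dln subr_ge0.
  by have l8 := l_ge8; lra.
move: XY_le; rewrite dell dln A0 !mul0r !add0r; exact.
Qed.

(** If [M <= M'], then [M'] also exceeds the champion and the estimate applies to both. The two
    errors sum to [16 * m ^ 2 / P ^ 2], below [1 / P] because [64 * m ^ 2 < P], whereas a difference
    of 1 in [ell] is worth [1 / P]. *)
Lemma champion_separation M M' : (champion <= M)%N -> (ell M <= ell champion + m)%N ->
  (ell M' < ell M)%N -> (M' < M)%N.
Proof.
move=> le_NM le_M lt_ell; rewrite ltnNge; apply/negP => le_MM'.
have le_M' : (ell M' <= ell champion + m)%N by apply: leq_trans le_M; apply: ltnW.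
have est := champion_log_estimate le_NM le_M.
have est' := champion_log_estimate (leq_trans le_NM le_MM') le_M'.
have M_gt0 := leq_trans champion_gt0 le_NM.
have le_ln : ln M%:R <= ln M'%:R :> R.
  by rewrite ler_ln ?posrE ?ltr0n ?(leq_trans M_gt0) // ler_nat.
have lt_ellR : (ell M')%:R + 1 <= (ell M)%:R :> R by rewrite natr1 ler_nat.
have mP : 64 * m%:R ^+ 2 < P%:R :> R by rewrite -natrX -natrM ltr_nat.
have le_q : ((ell M')%:R - (ell champion)%:R) / P%:R + P%:R^-1 <=
  ((ell M)%:R - (ell champion)%:R) / P%:R :> R.
  rewrite -subr_ge0 [leRHS](_ : _ = ((ell M)%:R - (ell M')%:R - 1) / P%:R); last by ring.
  by rewrite divr_ge0 ?(ltW P_gt0) //; lra.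
have small : 16 * m%:R ^+ 2 / P%:R ^+ 2 < P%:R^-1 :> R.
  rewrite -[ltRHS](mulfK (lt0r_neq0 P_gt0)) mulVf ?lt0r_neq0 // mul1r.
  rewrite ltr_pdivrMr ?exprn_gt0 // expr2 mulKf ?lt0r_neq0 //.
  by have : 0 <= m%:R ^+ 2 :> R := sqr_ge0 _; lra.
move: est est'; rewrite !ler_norml => /andP[? ?] /andP[? ?].
lra.
Qed.

End Superchampion.

Local Close Scope ring_scope.

(** * Exchanging primes in the superchampion *)

Lemma big_mem_index_iota (V : Type) (idx : V) (op : Monoid.com_law idx)
    (s : seq nat) B (F : nat -> V) :
  uniq s -> (forall p, p \in s -> p < B) ->
  \big[op/idx]_(0 <= p < B | p \in s) F p = \big[op/idx]_(p <- s) F p.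
Proof.
move=> uniq_s lt_s; rewrite -big_filter; apply: perm_big.
apply: uniq_perm; rewrite ?filter_uniq ?iota_uniq // => p.
by rewrite mem_filter mem_index_iota /=; case: (boolP (p \in s)) => // /lt_s.
Qed.

Lemma leq_prod_expn (s : seq nat) P : (forall p, p \in s -> p <= P) ->
  \prod_(p <- s) p <= P ^ size s.
Proof.
elim: s => [|p s IHs] le_s; first by rewrite big_nil.
rewrite big_cons expnS leq_mul ?le_s ?mem_head //.
by apply: IHs => q qs; rewrite le_s // inE qs orbT.
Qed.

Lemma geq_prod_expn (s : seq nat) P : (forall p, p \in s -> P <= p) ->
  P ^ size s <= \prod_(p <- s) p.
Proof.
elim: s => [|p s IHs] ge_s; first by rewrite big_nil.
rewrite big_cons expnS leq_mul ?ge_s ?mem_head //.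
by apply: IHs => q qs; rewrite ge_s // inE qs orbT.
Qed.

Section CloseJumps.
Variables (R : realType) (P m : nat).
Hypotheses (P_prime : prime P) (l_ge8 : (8 <= ln (P%:R : R))%R).
Hypotheses (l_small : (16 * ln P%:R ^+ 2 <= (P%:R : R))%R) (m_small : 64 * m ^ 2 < P).

(** Primes of [S] have exponent 1 in the champion and those of [Q] exponent 0, so the exchange only
    replaces some summands of [ell]. The product does not decrease, as the members of [S] are at
    most [P] and those of [Q] are above it. *)
Lemma champion_swap (S Q : seq nat) :
  uniq S -> (forall p, p \in S -> [/\ prime p, p <= P & P <= 4 * p]) ->
  uniq Q -> (forall q, q \in Q -> prime q /\ P < q) -> size S = size Q ->
  exists2 M, champion R P <= M & ell M + sumn S = ell (champion R P) + sumn Q.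
Proof.
move=> uniq_S S_le uniq_Q Q_gt size_SQ.
pose a := champ_exp R P; pose b p := a p + (p \in Q) - (p \in S).
have aS p : p \in S -> a p = 1 by case/S_le => *; apply: (champ_exp_left (m := m)).
have aQ q : q \in Q -> a q = 0 by case/Q_gt => *; apply: champ_exp_right.
have SQ p : p \in S -> p \notin Q.
  case/S_le => _ le_pP _; apply/negP => /Q_gt[_]; by rewrite ltnNge le_pP.
have bE p : [\/ p \in S /\ [/\ p \notin Q, a p = 1 & b p = 0],
   p \notin S /\ [/\ p \in Q, a p = 0 & b p = 1] |
   p \notin S /\ (p \notin Q /\ b p = a p)].
  have [pS|pS] := boolP (p \in S).
    by apply: Or31; rewrite /b aS // SQ // pS (negPf (SQ p pS)).
  have [pQ|pQ] := boolP (p \in Q); [apply: Or32|apply: Or33].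
    by rewrite /b aQ // pQ (negPf pS).
  by rewrite /b (negPf pS) (negPf pQ) addn0 subn0.
have b_pr p : 0 < b p -> prime p.
  case: (bE p) => [[_ [_ _ ->]]//|[_ [/Q_gt[]]]//|[_ [_ ->]]].
  exact: champ_exp_gt0_prime.
pose B := (P + sumn Q).+1; pose M := \prod_(0 <= p < B) p ^ b p.
have lt_SB p : p \in S -> p < B by case/S_le => _ le_pP _; rewrite ltnS (leq_trans le_pP) ?leq_addr.
have lt_QB q : q \in Q -> q < B.
  move=> qQ; rewrite ltnS; apply: leq_trans (leq_addl _ _).
  by rewrite sumnE (big_rem q) //= leq_addr.
have b0 p : B <= p -> b p = 0.
  move=> le_Bp; case: (bE p) => [[_ [_ _ ->]]//|[_ [/lt_QB]]|[_ [_ ->]]].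
    by rewrite ltnNge le_Bp.
  by apply: champ_exp_right => //; apply: leq_trans le_Bp; rewrite ltnS leq_addr.
have lognM p : logn p M = b p.
  by rewrite logn_prod_exp //; case: ltnP => // /b0.
have M_gt0 : 0 < M.
  apply: prodn_gt0 => p; have [->|/b_pr/prime_gt0 p0] := posnP (b p) => //.
  by rewrite expn_gt0 p0.
set N := champion R P; have N_gt0 : 0 < N by exact: champion_gt0.
have lognN p : logn p N = a p by apply: logn_champion.
(* A common range for the factorisations of [M] and [N] and for the members of [S] and [Q]. *)
pose B0 := M + N + B.
have ltM : 0 < M < B0 by rewrite M_gt0 /B0 /B -!addnA -{1}[M]addn0 ltn_add2l addnS.
have ltN : 0 < N < B0 by rewrite N_gt0 /B0 /B addnAC -{1}[N]add0n ltn_add2r addnS.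
have lt_SB0 p : p \in S -> p < B0 by move/lt_SB/leq_trans; apply; rewrite leq_addl.
have lt_QB0 p : p \in Q -> p < B0 by move/lt_QB/leq_trans; apply; rewrite leq_addl.
exists M.
  have prodS : \prod_(p <- S) p = \prod_(0 <= p < B0) p ^ (p \in S).
    rewrite -(@big_mem_index_iota _ _ _ S B0) // big_mkcond /=.
    by apply: eq_bigr => p _; case: (p \in S).
  have prodQ : \prod_(p <- Q) p = \prod_(0 <= p < B0) p ^ (p \in Q).
    rewrite -(@big_mem_index_iota _ _ _ Q B0) // big_mkcond /=.
    by apply: eq_bigr => p _; case: (p \in Q).
  have eqMN : N * \prod_(p <- Q) p = M * \prod_(p <- S) p.
    rewrite -{1}(prod_logn ltM) -{1}(prod_logn ltN) prodS prodQ -!big_split /=.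
    apply: eq_bigr => p _; rewrite lognM lognN -!expnD; congr (_ ^ _).
    case: (bE p) => [[-> [/negPf-> -> ->]]|[/negPf-> [-> -> ->]]|[/negPf-> [/negPf-> ->]]] //.
  have S_le_Q : \prod_(p <- S) p <= \prod_(p <- Q) p.
    apply: (@leq_trans (P ^ size S)); first by apply: leq_prod_expn => p /S_le[].
    by rewrite size_SQ; apply: geq_prod_expn => q /Q_gt[_ /ltnW].
  have Q_pos : 0 < \prod_(p <- Q) p.
    by rewrite big_seq prodn_cond_gt0 // => q /Q_gt[/prime_gt0].
  by rewrite -(leq_pmul2r Q_pos) eqMN leq_mul2l S_le_Q orbT.
have sumS : sumn S = \sum_(0 <= p < B0) (p \in S) * p.
  rewrite sumnE -(@big_mem_index_iota _ _ _ S B0) // big_mkcond /=.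
  by apply: eq_bigr => p _; case: (p \in S); rewrite ?mul1n ?mul0n.
have sumQ : sumn Q = \sum_(0 <= p < B0) (p \in Q) * p.
  rewrite sumnE -(@big_mem_index_iota _ _ _ Q B0) // big_mkcond /=.
  by apply: eq_bigr => p _; case: (p \in Q); rewrite ?mul1n ?mul0n.
rewrite (@ell_widen M B0) ?(@ell_widen N B0); try by [case/andP: ltM | case/andP: ltN].
rewrite sumS sumQ -!big_split /=; apply: eq_bigr => p _; rewrite lognM lognN.
by case: (bE p) => [[-> [/negPf-> -> ->]]|[/negPf-> [-> -> ->]]|[/negPf-> [/negPf-> ->]]];
  rewrite //= ?mul0n ?mul1n ?expn1 ?add0n ?addn0.
Qed.

Hypothesis steps_large : forall p j, prime p -> 0 < j -> (m%:R < `|cost_step R P p j|)%R.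

(** The witnesses are [ell M1] and [ell M2] for the two exchanged numbers: by separation every
    number with a smaller [ell] is itself smaller. *)
Lemma jumps_of_swaps (S Q1 Q2 : seq nat) :
  uniq S -> (forall p, p \in S -> [/\ prime p, p <= P & P <= 4 * p]) ->
  uniq Q1 -> (forall q, q \in Q1 -> prime q /\ P < q) -> size S = size Q1 ->
  uniq Q2 -> (forall q, q \in Q2 -> prime q /\ P < q) -> size S = size Q2 ->
  sumn S <= sumn Q1 -> sumn Q1 < sumn Q2 -> sumn Q2 <= sumn S + m ->
  exists n1 n2, [/\ P <= n1, n2 <= n1 + (sumn Q2 - sumn Q1), landau_jump n1 & landau n1 < landau n2].
Proof.
move=> uS SP uQ1 Q1P s1 uQ2 Q2P s2 leS1 lt12 le2m.
have [M1 le1 ell1] := champion_swap uS SP uQ1 Q1P s1.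
have [M2 le2 ell2] := champion_swap uS SP uQ2 Q2P s2.
set N := champion R P in le1 le2 ell1 ell2.
have N_gt0 : 0 < N by exact: champion_gt0.
have sep := champion_separation P_prime l_ge8 l_small m_small steps_large.
have le_m1 : ell M1 <= ell N + m by lia.
have le_m2 : ell M2 <= ell N + m by lia.
(* This makes the jump at least [P]; in particular [ell M1] is positive, so its predecessor is
   strictly smaller. *)
have P_le : P <= ell N.
  have dvd_P : P %| N.
    have := pfactor_dvdn 1 P_prime N_gt0; rewrite expn1 => ->.
    by rewrite logn_champion // (champ_exp_left (m := m)) //; lia.
  rewrite (@ell_widen N N.+1) // (bigD1_seq P) ?iota_uniq //=; last first.
    by rewrite mem_index_iota ltnS (dvdn_leq N_gt0 dvd_P).
  rewrite logn_champion // (champ_exp_left (m := m)) //; last lia.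
  by rewrite mul1n expn1 leq_addr.
exists (ell M1), (ell M2); split; try lia.
  rewrite /landau_jump; have [M [M_gt0 leM ->]] := landau_witness (ell M1).-1.
  apply: leq_trans (leq_landau (leq_trans N_gt0 le1) (leqnn _)).
  apply: sep => //; have := prime_gt0 P_prime; lia.
have [M [M_gt0 leM ->]] := landau_witness (ell M1).
apply: leq_trans (leq_landau (leq_trans N_gt0 le2) (leqnn _)).
by apply: sep => //; lia.
Qed.

End CloseJumps.

(** * Differences of primes *)

(* Bezout over a list, modulo [d], so that the coefficients can be kept nonnegative and then
   reduced modulo [d]. *)
Lemma gcd_combination_mod (d : nat) (s : seq nat) : 0 < d -> uniq s ->
  exists c : nat -> nat,
    \sum_(x <- s) c x * x = foldr gcdn d s %[mod d].
Proof.
move=> d_gt0; elim: s => [|x s IHs] /=.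
  by exists (fun _ => 0); rewrite big_nil mod0n modnn.
case/andP=> xs /IHs[c cE]; set g := foldr gcdn d s in cE *.
have g_gt0 : 0 < g by rewrite /g; elim: (s) => //= y r IH; rewrite gcdn_gt0 IH orbT.
have [kg kx eq_k _] := egcdnP x g_gt0.
(* Bezout needs the coefficient [- kx] at [x]; [kx * d.-1] is congruent to it modulo [d]. *)
exists (fun y => if y == x then kx * d.-1 else kg * c y).
rewrite big_cons eqxx.
have -> : \sum_(y <- s) (if y == x then kx * d.-1 else kg * c y) * y =
    kg * \sum_(y <- s) c y * y.
  rewrite big_distrr /= !big_seq; apply: eq_bigr => y ys.
  by case: eqP => [eyx|_]; [rewrite -eyx ys in xs | rewrite mulnA].
rewrite -modnDmr -modnMmr cE modnMmr modnDmr eq_k gcdnC.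
have -> : kx * d.-1 * x + (kx * x + gcdn x g) = kx * x * d + gcdn x g.
  by rewrite -{2}(prednK d_gt0); lia.
by rewrite modnMDl.
Qed.

Section Windows.
Variables (I : finType) (A : I -> seq nat) (H : nat).

Definition window_difference (d : nat) : {set I} :=
  [set i | has (fun x => x + d \in A i) (A i)].

Definition popular (T d : nat) : bool := (0 < d < H) && (T <= #|window_difference d|).

Definition window_pair (e : I * (nat * nat)) : bool :=
  (e.2.1 \in A e.1) && (e.2.2 \in A e.1).

(** A union bound: each of the fewer than [H] unpopular differences occurs in fewer than [T]
    windows, so together they miss some window. *)
Lemma popular_window T : (forall i x y, x \in A i -> y \in A i -> y < x + H) ->
  H * T < #|I| ->
  exists i, forall x y, x \in A i -> y \in A i -> x < y -> popular T (y - x).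
Proof.
move=> lt_H ltHT.
pose U := \bigcup_(d < H | ~~ popular T d && (0 < d)) window_difference d.
have le_U : #|U| <= H * T.
  have /leq_trans-> // : #|U| <=
      \sum_(d < H | ~~ popular T d && (0 < d)) #|window_difference d|.
    rewrite /U; elim/big_rec2: _ => [|d x Y _ le_xY]; first by rewrite cards0.
    by apply: leq_trans (leq_card_setU _ _) _; rewrite leq_add2l.
  apply: (@leq_trans (\sum_(d < H) T)); last by rewrite sum_nat_const card_ord.
  rewrite big_mkcond /=; apply: leq_sum => d _; case: ifP => // /andP[].
  by rewrite /popular ltn_ord andbT => np d0; move: np; rewrite d0 /= -ltnNge => /ltnW.
have /fintype.subsetPn[i _ iU] : ~~ ([set: I] \subset U).
  by apply: contraL ltHT => /subset_leq_card; rewrite cardsT -leqNgt => /leq_trans->.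
exists i => x y xi yi lt_xy; apply: contraR iU => np.
have lt_d : y - x < H by have := lt_H i x y xi yi; lia.
apply/bigcupP; exists (Ordinal lt_d); first by rewrite np subn_gt0.
by rewrite inE; apply/hasP; exists x; rewrite // subnKC // ltnW.
Qed.

(** A greedy choice: a popular difference occurs in at least [T] windows, so one remains outside [F]
    and the windows already used. *)
Lemma popular_pairs T (v : seq nat) (F : {set I}) :
  {in v, forall d, popular T d} -> size v + #|F| <= T ->
  exists t : seq (I * (nat * nat)),
    [/\ size t = size v, uniq [seq e.1 | e <- t],
        {in t, forall e, window_pair e && (e.1 \notin F)} &
        sumn [seq e.2.2 | e <- t] = sumn [seq e.2.1 | e <- t] + sumn v].
Proof.
elim: v F => [|d v IHv] F pop_v le_T; first by exists [::].
have pop_v' : {in v, forall d, popular T d}.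
  by move=> k kv; apply: pop_v; rewrite inE kv orbT.
have [/fintype.subsetP sub|/fintype.subsetPn[i]] := boolP (window_difference d \subset F).
  have /andP[_ le_d] := pop_v d (mem_head d v).
  have := leq_trans le_d (subset_leq_card (introT fintype.subsetP sub)).
  by move: le_T => /= le_T le_F; lia.
rewrite inE => /hasP[x xi xdi] iF.
have [|t [st ut vt sum_t]] := IHv (i |: F) pop_v'.
  by move: le_T; rewrite cardsU1 iF /=; lia.
exists ((i, (x, x + d)) :: t); split=> /=.
- by rewrite st.
- rewrite ut andbT; apply/mapP => -[e /vt/andP[_]]; rewrite !inE negb_or => /andP[/eqP ne _].
  by move=> ei; apply: ne.
- move=> e; rewrite inE => /predU1P[->|/vt/andP[-> ]]; first by rewrite /window_pair xi xdi.
  by rewrite inE negb_or => /andP[_ ->].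
- by rewrite sum_t; lia.
Qed.

(** [D] is the gcd of all popular differences. A combination giving [D] modulo one of them, [d1],
    has coefficients below [d1 < H]; multiples of [d1] then correct it exactly. At most [H ^ 2 + 1]
    pairs are used upwards and [H + H ^ 3] downwards, whence [T >= 4 * H ^ 3]. *)
Lemma gcd_of_windows T : 0 < H -> 4 * H ^ 3 <= T -> H * T < #|I| ->
  (forall i x y, x \in A i -> y \in A i -> y < x + H) ->
  (forall i, exists x y, [/\ x \in A i, y \in A i & x < y]) ->
  exists D, [/\ 0 < D,
    exists i, forall x y, x \in A i -> y \in A i -> x < y -> D %| y - x &
    exists t : seq (I * (nat * nat)),
    [/\ size t <= T, uniq [seq e.1 | e <- t], {in t, forall e, window_pair e} &
        sumn [seq e.2.2 | e <- t] = sumn [seq e.2.1 | e <- t] + D]].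
Proof.
move=> H_gt0 leT ltHT lt_H two.
have [i0 pop_i0] := popular_window lt_H ltHT.
have [d1 pop1] : exists d, popular T d.
  by have [x [y [xi yi lt_xy]]] := two i0; exists (y - x); apply: pop_i0.
have /andP[/andP[d1_gt0 d1_lt] _] := pop1.
pose s := [seq d <- iota 0 H | popular T d].
have us : uniq s by rewrite filter_uniq ?iota_uniq.
have size_s : size s <= H by rewrite size_filter -[leqRHS](size_iota 0); apply: count_size.
have pop_s d : d \in s -> popular T d by rewrite mem_filter => /andP[].
have s_pop d : popular T d -> d \in s.
  by move=> pd; rewrite mem_filter pd mem_iota; case/andP: pd => /andP[_].
pose D := foldr gcdn d1 s.
have D_dvd d : popular T d -> D %| d.
  move=> /s_pop; rewrite /D; elim: (s) => //= y r IHr; rewrite inE => /predU1P[->|/IHr].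
    exact: dvdn_gcdl.
  by apply: dvdn_trans; apply: dvdn_gcdr.
have D_gt0 : 0 < D.
  by rewrite lt0n; apply: contraL (D_dvd _ pop1) => /eqP->; rewrite dvd0n -lt0n.
exists D; split=> //.
  by exists i0 => x y xi yi lt_xy; apply/D_dvd/pop_i0.
have [c cE] := gcd_combination_mod d1_gt0 us; rewrite -/D in cE.
pose u := flatten [seq nseq (c d %% d1) d | d <- s].
have sum_u : sumn u = \sum_(d <- s) (c d %% d1) * d.
  rewrite /u; elim: (s) => [|d r IHr] /=; first by rewrite big_nil.
  by rewrite sumn_cat IHr big_cons sumn_nseq mulnC.
have size_u : size u <= H ^ 2.
  apply: (@leq_trans (size s * H)); last by rewrite expnS expn1 leq_mul2r size_s orbT.
  rewrite /u; elim: (s) => //= d r IHr; rewrite size_cat size_nseq mulSn leq_add //.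
  by apply: leq_trans (ltnW d1_lt); rewrite ltnW // ltn_pmod.
have mem_u d : d \in u -> popular T d.
  by case/flatten_mapP => k ks; rewrite mem_nseq => /andP[_ /eqP->]; apply: pop_s.
have sum_u_le : sumn u <= H ^ 3.
  apply: (@leq_trans (size u * H)); last by rewrite [H ^ 3]expnSr leq_mul2r size_u orbT.
  elim: (u) mem_u => //= d r IHr mem_r; rewrite mulSn leq_add ?IHr //.
    by have /andP[/andP[_ /ltnW]] := mem_r d (mem_head d r).
  by move=> k kr; apply: mem_r; rewrite inE kr orbT.
have le_D : D <= d1 by apply: dvdn_leq => //; apply: D_dvd.
(* The extra [d1] guarantees that the sum is at least [D], so the number [k] of copies of [d1] to
   remove is a natural number. *)
have /eqP : d1 + sumn u = D %[mod d1].
  rewrite modnDl sum_u -cE; elim: (s) => [|d r IHr]; first by rewrite !big_nil.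
  by rewrite !big_cons -modnDm IHr modnMml modnDm.
rewrite eqn_mod_dvd ?(leq_trans le_D) ?leq_addr // => /dvdnP[k def_k].
have le_k : k <= H + H ^ 3.
  apply: (@leq_trans (d1 + sumn u)); last by rewrite leq_add // ltnW.
  by apply: leq_trans (leq_subr D _); rewrite def_k leq_pmulr.
have H3 : H <= H ^ 3 by rewrite -{1}[H]expn1 leq_pexp2l.
have H23 : H ^ 2 <= H ^ 3 by rewrite leq_pexp2l.
have H1 : 1 <= H ^ 3 by rewrite expn_gt0 H_gt0.
have [||t1 [st1 ut1 vt1 sum1]] := @popular_pairs T (d1 :: u) finset.set0.
- by move=> d; rewrite inE => /predU1P[->//|/mem_u].
- rewrite cards0 addn0 /=; lia.
pose F := [set i in [seq e.1 | e <- t1]].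
have card_F : #|F| <= (size u).+1.
  by rewrite cardsE; apply: leq_trans (card_size _) _; rewrite size_map st1.
have [||t2 [st2 ut2 vt2 sum2]] := @popular_pairs T (nseq k d1) F.
- by move=> d; rewrite mem_nseq => /andP[_ /eqP->].
- rewrite size_nseq; lia.
(* Reversing a pair subtracts its difference instead of adding it. *)
pose flip (e : I * (nat * nat)) := (e.1, (e.2.2, e.2.1)).
exists (t1 ++ map flip t2); split.
- by rewrite size_cat size_map st1 st2 size_nseq /=; lia.
- rewrite map_cat cat_uniq ut1 -map_comp ut2 andbT /=; apply/hasPn => i.
  by case/mapP => e /vt2/andP[_]; rewrite inE => eF ->.
- move=> e; rewrite mem_cat => /orP[/vt1/andP[]//|/mapP[e' /vt2/andP[]]].
  by rewrite /window_pair => /andP[? ?] _ -> /=; apply/andP.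
rewrite !map_cat !sumn_cat -!map_comp sum1.
have -> : sumn [seq ((fun e => e.2.2) \o flip) e | e <- t2] = sumn [seq e.2.1 | e <- t2] by [].
have -> : sumn [seq ((fun e => e.2.1) \o flip) e | e <- t2] = sumn [seq e.2.2 | e <- t2] by [].
rewrite sum2 sumn_nseq /=; have := leq_trans le_D (leq_addr (sumn u) d1); lia.
Qed.

End Windows.

(** * Blocks with many dense windows *)

(** In Legendre's formula each [k] contributes at most 1, and nothing once [p ^ k] exceeds
    [2 * n]. *)
Lemma logn_central_bin p n : prime p -> 0 < n ->
  logn p 'C(n.*2, n) <= trunc_log p n.*2.
Proof.
move=> p_pr n_gt0; have p_gt1 := prime_gt1 p_pr.
have bin_gt : 0 < 'C(n.*2, n) by rewrite bin_gt0 -addnn leq_addr.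
have eqf := bin_fact (leq_trans (leq_addr n n) (eq_leq (addnn n))).
have -> : logn p 'C(n.*2, n) = logn p (n.*2)`! - 2 * logn p n`!.
  have e2 : n.*2 - n = n by rewrite -addnn addnK.
  rewrite -eqf e2 !lognM ?muln_gt0 ?fact_gt0 //.
  by move: (logn _ _) (logn _ _) => x y; lia.
rewrite leq_subLR !logn_fact //.
have -> : \sum_(1 <= k < n.+1) n %/ p ^ k = \sum_(1 <= k < n.*2.+1) n %/ p ^ k.
  rewrite [RHS](@big_cat_nat _ _ _ n.+1) //=; last by rewrite ltnS -addnn leq_addr.
  rewrite [X in _ = _ + X]big_nat [X in _ = _ + X]big1 ?addn0 // => k /andP[lt_nk _].
  by rewrite divn_small // (leq_trans lt_nk) // ltnW // ltn_expl.
rewrite big_distrr /=.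
set L := trunc_log p n.*2.
apply: (@leq_trans (\sum_(1 <= k < n.*2.+1) (2 * (n %/ p ^ k) + (k <= L)))).
  apply: leq_sum => k _; have pk : 0 < p ^ k by rewrite expn_gt0 ltnW.
  have [le_kL|lt_Lk] := leqP k L.
    rewrite -ltnS ltn_divLR // -mul2n; have := ltn_ceil n pk; nia.
  rewrite divn_small // (leq_trans (trunc_log_ltn _ p_gt1)) //.
  by rewrite leq_pexp2l // ltnW.
rewrite big_split /= leq_add2l.
have := sum1_size [seq k <- index_iota 1 n.*2.+1 | k <= L].
rewrite big_filter big_mkcond /= => eqs.
have -> : \sum_(1 <= k < n.*2.+1) (k <= L) =
    \sum_(1 <= k < n.*2.+1) (if k <= L then 1 else 0).
  by apply: eq_bigr => k _; case: (k <= L).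
rewrite eqs -[leqRHS](size_iota 1); apply: uniq_leq_size.
  by rewrite filter_uniq ?iota_uniq.
by move=> k; rewrite mem_filter mem_index_iota mem_iota add1n => /andP[le_k /andP[-> _]]; rewrite ltnS.
Qed.

Lemma expn2_leq_central_bin n : 2 ^ n <= 'C(n.*2, n).
Proof.
elim: n => // n IHn; rewrite doubleS expnS mul2n -addnn binS.
apply: leq_add; apply: (leq_trans IHn); first by rewrite binS leq_addl.
by case: n {IHn} => [|n]; rewrite ?bin0 // doubleS binS leq_addr.
Qed.

Definition prime_count (n : nat) : nat := \sum_(0 <= p < n.+1) prime p.

Lemma central_bin_leq n : 0 < n -> 'C(n.*2, n) <= n.*2 ^ prime_count n.*2.
Proof.
move=> n_gt0; set c := 'C(n.*2, n).
have c_gt0 : 0 < c by rewrite bin_gt0 -addnn leq_addr.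
have n2_gt0 : 0 < n.*2 by rewrite double_gt0.
pose B := c + n.*2.+1.
have ltc : 0 < c < B by rewrite c_gt0 /B addnS ltnS leq_addr.
rewrite -[leqLHS](prod_logn ltc) (@big_cat_nat _ _ _ n.*2.+1) //=; last exact: leq_addl.
have npr p : ~~ prime p -> logn p c = 0 by move=> np; rewrite lognE (negPf np).
rewrite [X in _ * X]big_nat [X in _ * X]big1 => [|p /andP[lt_p _]].
  rewrite muln1 /prime_count expn_sum; apply: leq_prod => p _.
  case: (boolP (prime p)) => [p_pr|/npr->] //.
  have p_gt1 := prime_gt1 p_pr.
  apply: leq_trans (trunc_logP p_gt1 n2_gt0).
  by rewrite leq_pexp2l ?logn_central_bin // ltnW.
case: (boolP (prime p)) => [p_pr|/npr->] //.
suff -> : logn p c = 0 by [].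
apply/eqP; rewrite -leqn0; apply: leq_trans (logn_central_bin p_pr n_gt0) _.
by rewrite leqn0 trunc_log_eq0 -[_ <= p.-1]ltnS prednK ?prime_gt0 // lt_p orbT.
Qed.

Lemma chebyshev_lower e : 0 < e -> 2 ^ e <= 2 * e * prime_count (2 ^ e).
Proof.
case: e => // e _; have := central_bin_leq (expn_gt0 2 e : 0 < 2 ^ e).
move/(leq_trans (expn2_leq_central_bin (2 ^ e))).
have -> : (2 ^ e).*2 = 2 ^ e.+1 by rewrite expnS mul2n.
by rewrite -expnM leq_exp2l // -mulnA [2 ^ e.+1]expnS leq_mul2l.
Qed.

(** * Primes in short windows *)

Definition window_primes (H w : nat) : seq nat := [seq p <- iota (w * H) H | prime p].

Lemma mem_window_primes H w p :
  (p \in window_primes H w) = prime p && (w * H <= p < w.+1 * H).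
Proof. by rewrite mem_filter mem_iota mulSn [w * H + H]addnC. Qed.

Lemma window_primes_uniq H w : uniq (window_primes H w).
Proof. by rewrite filter_uniq ?iota_uniq. Qed.

(** The primes of the window lie in one progression of difference [D]. The sieve allows only about
    [8 * H / (totient D * i)] of them, while density asks for [H / (k * i)]; so
    [totient D <= 16 * k]. *)
Lemma dense_class_bound (i k w D : nat) : let u := 2 ^ i in let H := u ^ 12 in
  0 < i -> 0 < k -> 4 * k * i <= u -> u ^ 2 < w * H -> 0 < D ->
  H <= k * i * size (window_primes H w) ->
  (forall x y, x \in window_primes H w -> y \in window_primes H w -> x < y -> D %| y - x) ->
  D <= 2 * (16 * k) ^ 2.
Proof.
move=> u H i_gt0 k_gt0 u_large z_lt D_gt0; set s := window_primes H w => dense congr_s.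
have u_gt0 : 0 < u by rewrite expn_gt0.
have H_gt0 : 0 < H by rewrite expn_gt0 u_gt0.
have leuH : u <= H by rewrite -{1}[u]expn1 leq_pexp2l.
have [x0 [y0 [x0s y0s lt_xy min_x0]]] : exists x y, [/\ x \in s, y \in s, x < y &
    forall z, z \in s -> x <= z].
  have size_s : 1 < size s.
    rewrite ltnNge; apply/negP => le1; have : k * i * size s <= k * i * 1.
      by rewrite leq_mul2l le1 orbT.
    by move: dense leuH u_large; nia.
  have : sorted ltn s by apply: sorted_filter (iota_ltn_sorted _ _); apply: ltn_trans.
  case: (s) size_s => [|x [|y r]] //= _ /andP[lt_xy pth].
  exists x, y; rewrite !inE !eqxx !orbT; split=> // z; rewrite !inE.
  case/or3P => [/eqP->|/eqP->|zr] //; first exact: ltnW.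
  have /allP/(_ z zr) := order_path_min ltn_trans pth.
  by move/(ltn_trans lt_xy)/ltnW.
have s_win y : y \in s -> prime y /\ w * H <= y < w.+1 * H.
  by rewrite mem_window_primes => /andP[].
have lt_sub y : y \in s -> y - x0 < H.
  by move=> /s_win[_ /andP[_]]; have [_ /andP[]] := s_win _ x0s; rewrite mulSn; lia.
have le_DH : D <= H.
  apply: leq_trans (ltnW (lt_sub _ y0s)); apply: dvdn_leq; first by rewrite subn_gt0.
  exact: congr_s.
(* [K] terms of the progression reach across the window. All its primes exceed [z], so they survive
   the sieve, whose error [z ^ 4 = u ^ 8] is small against [H = u ^ 12]. *)
pose K := (H %/ D).+1; pose z := u ^ 2.
pose pk j := [forall p : 'I_z.+1, prime p ==> ~~ (p %| x0 + j * D)].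
have z_gt0 : 0 < z by rewrite expn_gt0 u_gt0.
have idxP y : y \in s -> x0 + (y - x0) %/ D * D = y.
  move=> ys; rewrite divnK ?subnKC ?min_x0 //.
  have := min_x0 y ys; rewrite leq_eqVlt => /predU1P[->|]; first by rewrite subnn.
  exact: congr_s.
have size_le : size s <= \sum_(0 <= j < K) pk j.
  have -> : \sum_(0 <= j < K) pk j = size [seq j <- index_iota 0 K | pk j].
    by rewrite -[RHS]sum1_size [RHS]big_filter [RHS]big_mkcond; apply: eq_bigr => j _; case: (pk j).
  rewrite -(size_map (fun y => (y - x0) %/ D)); apply: uniq_leq_size.
    rewrite map_inj_in_uniq ?window_primes_uniq // => x y xs ys /= e.
    by rewrite -(idxP x xs) -(idxP y ys) e.
  move=> _ /mapP[y ys ->]; rewrite mem_filter mem_index_iota /= ltnS leq_div2r ?andbT; last first.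
    exact/ltnW/lt_sub.
  apply/forallP => p; apply/implyP => p_pr; rewrite idxP //.
  have [y_pr /andP[le_y _]] := s_win y ys.
  rewrite dvdn_prime2 // neq_ltn; apply/orP; left.
  by apply: leq_ltn_trans (leq_trans z_lt le_y); rewrite -ltnS.
have KD : K * D <= 2 * H.
  by rewrite mulSn; have := leq_trunc_div H D; lia.
(* Counting terms alone gives this crude bound; it yields [D <= u], hence [2 ^ i * D <= z] as the
   mass estimate requires. *)
have le_D : D <= 2 * k * i.
  have sK : size s <= K.
    apply: leq_trans size_le _; rewrite -[leqRHS]subn0 -[leqRHS]muln1 -sum_nat_const_nat.
    by apply: leq_sum => j _; apply: leq_b1.
  have : D * H <= 2 * k * i * H.
    apply: (@leq_trans (D * (k * i * K))).
      by rewrite leq_mul2l (leq_trans dense) ?orbT // leq_mul2l sK orbT.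
    by move: KD; nia.
  by rewrite leq_mul2r => /orP[/eqP H0|//]; rewrite H0 in H_gt0.
pose phi := totient D.
have phi_gt0 : 0 < phi by rewrite totient_gt0.
have le_phi : phi <= u.
  apply: (@leq_trans D); last by move: le_D u_large; nia.
  rewrite /phi totient_count_coprime -[leqRHS]subn0 -[leqRHS]muln1 -sum_nat_const_nat.
  by apply: leq_sum => j _; apply: leq_b1.
have main : size s * phi * i <= 8 * H + u ^ 8 * phi * i.
  have J_ge : (phi%:R * i%:R / (4 * D%:R) <= sieve_mass rat D z)%R.
    apply: sieve_mass_ge => //; rewrite -/u /z expnS expn1 leq_mul2l.
    by rewrite (leq_trans le_D) ?orbT //; move: u_large; nia.
  have := @sieve_upper_bound rat x0 D z K z_gt0; rewrite -/pk => bound.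
  have D0 : (0 < D%:R :> rat)%R by rewrite ltr0n.
  have pi0 : (0 < phi%:R * i%:R :> rat)%R by rewrite mulr_gt0 ?ltr0n.
  have le_K : (K%:R / sieve_mass rat D z <= 8 * H%:R / (phi%:R * i%:R))%R.
    have J0 := lt_le_trans (divr_gt0 pi0 (mulr_gt0 (ltr0n rat 4) D0)) J_ge.
    rewrite ler_pdivrMr //.
    apply: (@le_trans _ _ (8 * H%:R / (phi%:R * i%:R) * (phi%:R * i%:R / (4 * D%:R)))%R).
      have -> : (8 * H%:R / (phi%:R * i%:R) * (phi%:R * i%:R / (4 * D%:R)) = 2 * H%:R / D%:R :> rat)%R.
        by field; rewrite !pnatr_eq0 -!lt0n D_gt0 phi_gt0 i_gt0.
      by rewrite ler_pdivlMr // -!natrM ler_nat.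
    by rewrite ler_wpM2l // divr_ge0 ?mulr_ge0 // ltW.
  have size_leR : ((size s)%:R <= 8 * H%:R / (phi%:R * i%:R) + z%:R ^+ 4 :> rat)%R.
    apply: le_trans (lerD le_K (lexx _)); apply: le_trans bound.
    by rewrite ler_nat.
  have := ler_wpM2r (ltW pi0) size_leR; rewrite mulrDl divfK ?gt_eqF //.
  by rewrite -natrX -!natrM -natrD ler_nat /z -expnM !mulnA.
have le_phik : phi <= 16 * k.
  have H8 : 2 * (k * i * u ^ 8) <= H.
    apply: (@leq_trans (u ^ 9)); last by rewrite leq_pexp2l.
    by rewrite [u ^ 9]expnS; move: u_large; nia.
  have : phi * H <= 16 * k * H.
    have m1 : H * phi <= k * (size s * phi * i) by move: dense; nia.
    have m2 : k * (size s * phi * i) <= k * (8 * H + u ^ 8 * phi * i).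
      by rewrite leq_mul2l main orbT.
    by move: m1 m2 H8; move: (u ^ 8) => U; nia.
  by rewrite leq_mul2r => /orP[/eqP H0|//]; rewrite H0 in H_gt0.
apply: leq_trans (leq_totient_sqr D_gt0) _.
by rewrite leq_mul2l leq_exp2r.
Qed.

(* [S] is taken out of the superchampion at [P], and [Q1] or [Q2] is put in. *)
Definition has_close_swaps (P m C : nat) : Prop := exists S Q1 Q2,
  [/\ uniq S /\ (forall p, p \in S -> [/\ prime p, p <= P & P <= 4 * p]),
      uniq Q1 /\ (forall q, q \in Q1 -> prime q /\ P < q),
      uniq Q2 /\ (forall q, q \in Q2 -> prime q /\ P < q),
      size S = size Q1 /\ size S = size Q2 &
      [/\ sumn S <= sumn Q1, sumn Q1 < sumn Q2, sumn Q2 <= sumn Q1 + C &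
          sumn Q2 <= sumn S + m]].

Lemma sumn_leq (s : seq nat) a : (forall x, x \in s -> x <= a) -> sumn s <= size s * a.
Proof.
elim: s => //= x s IHs le_a; rewrite mulSn leq_add ?le_a ?mem_head //.
by apply: IHs => y ys; rewrite le_a // inE ys orbT.
Qed.

Lemma sumn_geq (s : seq nat) a : (forall x, x \in s -> a <= x) -> size s * a <= sumn s.
Proof.
elim: s => //= x s IHs ge_a; rewrite mulSn leq_add ?ge_a ?mem_head //.
by apply: IHs => y ys; rewrite ge_a // inE ys orbT.
Qed.

Lemma uniq_map_inj_in (T1 T2 : eqType) (f : T1 -> T2) (s : seq T1) :
  uniq [seq f x | x <- s] -> {in s &, injective f}.
Proof.
elim: s => //= x s IHs /andP[fx us] y z; rewrite !inE.
case/predU1P=> [->|ys] /predU1P[->|zs] // eq_f; last exact: IHs.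
  by rewrite eq_f map_f in fx.
by rewrite -eq_f map_f in fx.
Qed.

Lemma window_eq H w w' p : p \in window_primes H w -> p \in window_primes H w' -> w = w'.
Proof.
rewrite !mem_window_primes => /andP[_ /andP[a1 a2]] /andP[_ /andP[b1 b2]].
apply/eqP; rewrite eqn_leq; apply/andP; split; rewrite -ltnS.
  by have := leq_ltn_trans a1 b2; rewrite ltn_mul2r => /andP[].
by have := leq_ltn_trans b1 a2; rewrite ltn_mul2r => /andP[].
Qed.

Section Blocks.
Variables i k : nat.
Let u := 2 ^ i.
Let H := u ^ 12.
Hypotheses (i_gt0 : 0 < i) (k_gt0 : 0 < k) (u_large : 4 * k * i <= u).

Definition dense_window (w : nat) : bool := H <= k * i * size (window_primes H w).

(** Block [b] runs from [b * H ^ 8] to [b.+1 * H ^ 8] and consists of [H ^ 7] consecutive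
    windows. *)
Definition dense_windows (b : nat) : seq nat :=
  [seq w <- iota (b * H ^ 7) (H ^ 7) | dense_window w].

(** The first [T] dense windows of the block supply [P] and the primes taken out, the later ones the
    pairs put in. More than [H * T] windows remain for the latter, as [H ^ 6] exceeds
    [H * T + T]. *)
Lemma block_swaps b : 0 < b -> H ^ 6 <= size (dense_windows b) ->
  exists P, [/\ prime P, b * H ^ 8 <= P < b.+1 * H ^ 8 &
                has_close_swaps P (H ^ 12) (2 * (16 * k) ^ 2)].
Proof.
move=> b_gt0; set ws := dense_windows b => size_ws.
have u_ge4 : 4 <= u by apply: leq_trans u_large; rewrite -mulnA leq_pmulr // muln_gt0 k_gt0.
have u_gt0 : 0 < u by exact: leq_trans u_ge4.
have leuH : u <= H by rewrite -{1}[u]expn1 leq_pexp2l.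
have H_gt0 : 0 < H by exact: leq_trans leuH.
have H_ge4 : 4 <= H by exact: leq_trans leuH.
pose T := 4 * H ^ 3.
have T_gt0 : 0 < T by rewrite muln_gt0 expn_gt0 H_gt0.
have size_large : H * T + T < size ws.
  apply: leq_trans size_ws; rewrite /T.
  rewrite -[6]/(3 + 3) expnD; have h_gt : 4 * H + 4 < H ^ 3.
    apply: (@leq_trans (16 * H)); first by lia.
    by rewrite expnSr leq_mul2r -[16]/(4 ^ 2) leq_exp2r // H_ge4 orbT.
  by move: (H ^ 3) h_gt => h h_gt; nia.
have leT_ws : T <= size ws by apply: leq_trans (ltnW size_large); apply: leq_addl.
have sorted_ws : sorted ltn ws.
  by apply: sorted_filter (iota_ltn_sorted _ _); apply: ltn_trans.
have ws_dense w : w \in ws -> dense_window w by rewrite mem_filter => /andP[].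
have ws_block w : w \in ws -> b * H ^ 7 <= w < b.+1 * H ^ 7.
  by rewrite mem_filter mem_iota mulSn [H ^ 7 + _]addnC => /andP[].
have uniq_ws : uniq ws by rewrite filter_uniq ?iota_uniq.
have dense_size w : dense_window w -> 1 < size (window_primes H w).
  rewrite /dense_window => dw; rewrite ltnNge; apply/negP => le1.
  have : k * i * size (window_primes H w) <= k * i * 1 by rewrite leq_mul2l le1 orbT.
  by move: dw leuH u_large; nia.
have in_block w p : w \in ws -> p \in window_primes H w ->
    prime p /\ b * H ^ 8 <= p < b.+1 * H ^ 8.
  move=> /ws_block/andP[le_w lt_w]; rewrite mem_window_primes => /andP[p_pr /andP[le_p lt_p]].
  split=> //; apply/andP; split.
    by apply: leq_trans le_p; rewrite expnSr mulnA leq_mul2r le_w orbT.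
  by apply: leq_trans lt_p _; rewrite expnSr mulnA leq_mul2r lt_w orbT.
pose pk w := head 0 (window_primes H w).
have pk_mem w : w \in ws -> pk w \in window_primes H w.
  by move=> /ws_dense/dense_size; rewrite /pk; case: (window_primes H w) => //= x r _; rewrite mem_head.
have lt_windows w w' p q : p \in window_primes H w -> q \in window_primes H w' -> w < w' -> p < q.
  rewrite !mem_window_primes => /andP[_ /andP[_ lt_p]] /andP[_ /andP[le_q _]] lt_w.
  by apply: leq_trans lt_p (leq_trans _ le_q); rewrite leq_mul2r lt_w orbT.
have lt_nth m n : m < n -> n < size ws -> nth 0 ws m < nth 0 ws n.
  move=> lt_mn lt_n; have := sorted_ltn_nth ltn_trans 0 sorted_ws.
  by move/(_ m n); rewrite !inE; apply=> //; apply: ltn_trans lt_n.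
(* [P] comes from the last of the first [T] dense windows, so it is at least every member of [S] and
   below every prime of the windows [A j]. *)
pose P := pk (nth 0 ws T.-1).
have T1_lt : T.-1 < size ws by rewrite prednK //; lia.
have P_mem : P \in window_primes H (nth 0 ws T.-1) by apply/pk_mem/mem_nth.
have [P_pr P_block] := in_block _ _ (mem_nth 0 T1_lt) P_mem.
pose I := 'I_(size ws - T).
pose A (j : I) := window_primes H (nth 0 ws (T + j)).
have ltj (j : I) : T + j < size ws by have := ltn_ord j; lia.
have A_block (j : I) p : p \in A j -> prime p /\ b * H ^ 8 <= p < b.+1 * H ^ 8.
  by apply: in_block; apply: mem_nth.
have A_gtP (j : I) p : p \in A j -> P < p.
  by move=> pj; apply: lt_windows P_mem pj _; apply: lt_nth => //; lia.
have lt_H (j : I) x y : x \in A j -> y \in A j -> y < x + H.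
  rewrite !mem_window_primes => /andP[_ /andP[le_x _]] /andP[_ /andP[_ lt_y]].
  by apply: leq_trans lt_y _; rewrite mulSn addnC leq_add2r.
have two (j : I) : exists x y, [/\ x \in A j, y \in A j & x < y].
  have := dense_size _ (ws_dense _ (mem_nth 0 (ltj j))).
  have : sorted ltn (A j) by apply: sorted_filter (iota_ltn_sorted _ _); apply: ltn_trans.
  rewrite -/(A j); case: (A j) => [|x [|y r]] //= /andP[lt_xy _] _.
  by exists x, y; rewrite !inE !eqxx orbT.
have [||//|//|D [D_gt0 [j congr_j] [t [size_t uniq_t mem_t sum_t]]]] :=
  @gcd_of_windows I A H T H_gt0 _ _.
- by [].
- by rewrite card_ord; lia.
have le_D : D <= 2 * (16 * k) ^ 2.
  apply: (@dense_class_bound i k (nth 0 ws (T + j)) D) => //; last first.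
    exact/ws_dense/mem_nth.
  have /andP[le_w _] := ws_block _ (mem_nth 0 (ltj j)).
  rewrite -/u -/H; apply: (@leq_trans (b * H ^ 7 * H)); last by rewrite leq_mul2r le_w orbT.
  rewrite -mulnA -expnSr; apply: (@leq_trans (H ^ 8)); last by rewrite leq_pmull.
  by rewrite /H -expnM ltn_exp2l // (leq_trans _ u_ge4).
have window_fst e f q : e \in t -> f \in t -> q \in A e.1 -> q \in A f.1 -> e = f.
  move=> et ft qe qf; have /eqP := window_eq qe qf.
  rewrite nth_uniq ?ltj // eqn_add2l => /eqP/val_inj efst.
  exact: (uniq_map_inj_in uniq_t).
exists P; split=> //.
pose Q1 := [seq e.2.1 | e <- t]; pose Q2 := [seq e.2.2 | e <- t].
pose S := take (size t) [seq pk w | w <- take T ws].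
have size_S : size S = size t.
  by rewrite size_takel // size_map size_takel.
have S_P p : p \in S -> [/\ prime p, p <= P & b * H ^ 8 <= p].
  move/mem_take/mapP => [w wT ->].
  have w_ws := mem_take wT.
  have [pr_p /andP[ge_p _]] := in_block _ _ w_ws (pk_mem _ w_ws).
  split=> //; have /(nthP 0)[n] := wT; rewrite size_takel //.
  move=> lt_n <-; rewrite nth_take //.
  have n_ws : n < size ws by apply: leq_trans leT_ws.
  have : n <= T.-1 by rewrite -ltnS prednK.
  rewrite leq_eqVlt => /predU1P[->//|lt].
  exact: ltnW (lt_windows _ _ _ _ (pk_mem _ (mem_nth 0 n_ws)) P_mem (lt_nth _ _ lt T1_lt)).
have uniq_S : uniq S.
  apply: take_uniq; rewrite map_inj_in_uniq ?take_uniq // => x y xT yT /= exy.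
  have := pk_mem _ (mem_take xT); rewrite exy => /window_eq; apply.
  exact: pk_mem (mem_take yT).
have Q_uniq (f : nat * nat -> nat) : {in t, forall e, f e.2 \in A e.1} ->
    uniq [seq f e.2 | e <- t].
  move=> fA; rewrite map_inj_in_uniq ?(map_uniq uniq_t) // => e e' et e't /= ee'.
  by apply: (window_fst _ _ (f e.2)); rewrite ?fA // ee' fA.
have inA1 : {in t, forall e, e.2.1 \in A e.1} by move=> e /mem_t/andP[].
have inA2 : {in t, forall e, e.2.2 \in A e.1} by move=> e /mem_t/andP[].
have Q1P q : q \in Q1 -> prime q /\ P < q < b.+1 * H ^ 8.
  by case/mapP => e /inA1 q_in ->; rewrite (A_gtP _ _ q_in); have [? /andP[]] := A_block _ _ q_in.
have Q2P q : q \in Q2 -> prime q /\ P < q < b.+1 * H ^ 8.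
  by case/mapP => e /inA2 q_in ->; rewrite (A_gtP _ _ q_in); have [? /andP[]] := A_block _ _ q_in.
exists S, Q1, Q2; split.
- split=> // p /S_P[pr_p le_p ge_p]; split=> //.
  have /andP[_] := P_block; rewrite mulSn => /ltnW/leq_trans; apply.
  have le8 : H ^ 8 <= b * H ^ 8 by rewrite leq_pmull.
  apply: (@leq_trans (2 * p)); last by rewrite leq_mul2r orbT.
  by rewrite mul2n -addnn leq_add // (leq_trans le8).
- by split=> [|q /Q1P[? /andP[]]//]; apply: (Q_uniq fst).
- by split=> [|q /Q2P[? /andP[]]//]; apply: (Q_uniq snd).
- by rewrite size_S !size_map.
have S_le : sumn S <= size t * P by rewrite -size_S; apply: sumn_leq => p /S_P[].
have S_ge : size t * (b * H ^ 8) <= sumn S by rewrite -size_S; apply: sumn_geq => p /S_P[].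
have Q1_ge : size t * P <= sumn Q1.
  by rewrite -(size_map (fun e => e.2.1) t); apply: sumn_geq => p /Q1P[_ /andP[/ltnW]].
have Q2_le : sumn Q2 <= size t * (b.+1 * H ^ 8).
  by rewrite -(size_map (fun e => e.2.2) t); apply: sumn_leq => p /Q2P[_ /andP[_ /ltnW]].
split.
- exact: leq_trans Q1_ge.
- by rewrite /Q2 sum_t -[ltnLHS]addn0 ltn_add2l.
- by rewrite /Q2 sum_t leq_add2l.
(* Each exchange moves a prime by at most the block length, so the total is at most
   [T * H ^ 8 = 4 * H ^ 11 <= H ^ 12]. *)
apply: leq_trans Q2_le _; rewrite mulSn mulnDr addnC; apply: leq_add S_ge _.
apply: (@leq_trans (T * H ^ 8)); first by rewrite leq_mul2r size_t orbT.
have -> : H ^ 12 = H * H ^ 3 * H ^ 8 by rewrite -expnS -expnD.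
by rewrite leq_mul2r leq_mul2r H_ge4 orbT orbT.
Qed.

End Blocks.

(** * Counting dense windows and good blocks *)

Lemma size_filter_iota (P : pred nat) w h :
  size [seq x <- iota (w * h) h | P x] = \sum_(w * h <= x < w.+1 * h) P x.
Proof.
rewrite -sum1_size big_filter big_mkcond /index_iota mulSn addnK.
by apply: eq_bigr => x _; case: (P x).
Qed.

Section Counting.
Variable i : nat.
(* [2 * (2 * 480)]: with [H = 2 ^ (12 * i)], Chebyshev's bound at [H ^ 40 = 2 ^ (480 * i)] gives
   primes of density at least [1 / (2 * 480 * i)]; a dense window has half of that. *)
Let k := 1920.
Let u := 2 ^ i.
Let H := u ^ 12.
Lemma length40_expn : H ^ 40 = 2 ^ (480 * i).
Proof. by rewrite /H /u -!expnM; congr (2 ^ _); lia. Qed.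

Hypotheses (i_gt0 : 0 < i) (u_large : 4 * k * i <= u).

(** The condition [H ^ 19 <= b] places the block above [H ^ 27]. *)
Definition good_block (b : nat) : bool :=
  (H ^ 19 <= b) && (H ^ 6 <= size (dense_windows i k b)).

(** Windows that are not dense hold at most half of the primes that Chebyshev's bound provides below
    [H ^ 40], and a dense window holds at most [H]. *)
Lemma many_dense_windows :
  H ^ 39 <= k * i * \sum_(0 <= w < H ^ 39) dense_window i k w.
Proof.
have H_gt0 : 0 < H by rewrite !expn_gt0.
have e_gt1 : 1 < 480 * i by move: i_gt0; lia.
have := chebyshev_lower (ltnW e_gt1); rewrite -length40_expn /prime_count.
rewrite big_nat_recr //=.
(* [prime_count] includes the endpoint, which lies in no window counted here; it is a proper power
   of 2. *)
have -> : prime (H ^ 40) = false.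
  apply/negP => H_pr; have : prime (H ^ 40) by []; rewrite length40_expn.
  have : 1 < 480 * i by []; case: (480 * i) => [|[|e]] // _.
  rewrite !expnS; apply/negP/primePn; right; exists 2; last exact: dvdn_mulr.
  have e0 : 0 < 2 ^ e by rewrite expn_gt0.
  by move: e0; lia.
rewrite addn0 expnSr big_nat_mul => cheb.
have le1 : \sum_(0 <= w < H ^ 39) k * i * (\sum_(w * H <= p < w.+1 * H) prime p) <=
   \sum_(0 <= w < H ^ 39) (k * i * H * dense_window i k w + H).
  apply: leq_sum => w _; rewrite -size_filter_iota -/(window_primes H w) /dense_window -/u -/H.
  have le_H : size (window_primes H w) <= H.
    by rewrite size_filter -[leqRHS](size_iota (w * H)) count_size.
  case: (leqP H (k * i * size (window_primes H w))) => [_|/ltnW]; last by rewrite muln0.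
  by rewrite muln1 (leq_trans _ (leq_addr _ _)) // leq_mul2l le_H orbT.
have kE : k * i = 2 * (2 * (480 * i)) by rewrite /k !mulnA.
rewrite -big_distrr big_split /= -big_distrr sum_nat_const_nat subn0 /= in le1.
have : 2 * (H ^ 39 * H) <= k * i * H * \sum_(0 <= w < H ^ 39) dense_window i k w + H ^ 39 * H.
  by apply: leq_trans le1; rewrite kE -mulnA leq_mul2l.
rewrite mul2n -addnn leq_add2r [leqRHS]mulnAC leq_mul2r.
by case/orP => [/eqP H0|//]; rewrite H0 in H_gt0.
Qed.

(** There are at least [4 * H ^ 38] dense windows, because [4 * k * i <= H]. The blocks with few of
    them and the blocks below [H ^ 19] account for at most [H ^ 38] each, and any block holds at
    most [H ^ 7]. *)
Lemma many_good_blocks : H ^ 31 <= \sum_(0 <= b < H ^ 32) good_block b.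
Proof.
have H_gt0 : 0 < H by rewrite !expn_gt0.
have leuH : u <= H by rewrite -{1}[u]expn1 leq_pexp2l // expn_gt0.
set G := \sum_(0 <= b < H ^ 32) good_block b.
have := many_dense_windows; rewrite -[39]/(32 + 7) expnD big_nat_mul.
under eq_bigr => b _ do rewrite -size_filter_iota -/(dense_windows i k b).
set N := \sum_(0 <= b < _) _ => many.
have leN : N <= G * H ^ 7 + H ^ 32 * H ^ 6 + H ^ 19 * H ^ 7.
  apply: (@leq_trans (\sum_(0 <= b < H ^ 32) (good_block b * H ^ 7 + H ^ 6 + (b < H ^ 19) * H ^ 7))).
    apply: leq_sum => b _; have le_H : size (dense_windows i k b) <= H ^ 7.
      by rewrite size_filter -[leqRHS](size_iota (b * H ^ 7)) count_size.
    rewrite /good_block; case: (ltnP b (H ^ 19)) => _ /=.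
      by rewrite mul1n (leq_trans le_H) // leq_addl.
    rewrite mul0n addn0.
    case: (leqP (H ^ 6) (size (dense_windows i k b))) => [_|/ltnW le6]; rewrite ?mul1n //.
    by rewrite (leq_trans le_H) // leq_addr.
  rewrite !big_split /= sum_nat_const_nat subn0 -!big_distrl /= leq_add2l leq_mul2r.
  apply/orP; right; have le19 : H ^ 19 <= H ^ 32 by rewrite leq_pexp2l.
  rewrite (@big_cat_nat _ _ _ (H ^ 19)) //= [X in _ + X]big_nat [X in _ + X]big1 => [|b /andP[ge_b _]].
    rewrite addn0 -[leqRHS]subn0 -[leqRHS]muln1 -sum_nat_const_nat.
    by apply: leq_sum => b _; apply: leq_b1.
  by rewrite ltnNge ge_b.
have le4 : 4 * (H ^ 32 * H ^ 7) <= H * N.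
  apply: (@leq_trans (4 * (k * i * N))); first by rewrite leq_mul2l many.
  by rewrite !mulnA leq_mul2r (leq_trans u_large leuH) orbT.
have e39 : H ^ 32 * H ^ 7 = H * (H ^ 31 * H ^ 7) by rewrite mulnA -expnS.
have e38 : H ^ 32 * H ^ 6 = H ^ 31 * H ^ 7 by rewrite -!expnD.
have le26 : H ^ 19 * H ^ 7 <= H ^ 31 * H ^ 7 by rewrite leq_mul2r leq_pexp2l ?orbT.
rewrite {}e38 in leN; rewrite {}e39 in le4.
have H7_gt0 : 0 < H ^ 7 by rewrite expn_gt0 H_gt0.
rewrite -(leq_pmul2r H7_gt0).
move: (H ^ 31 * H ^ 7) (H ^ 19 * H ^ 7) (G * H ^ 7) leN le26 le4 => x y z leN le_yx.
by rewrite (mulnCA 4 H) leq_pmul2l //; lia.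
Qed.

End Counting.

(** * Avoiding the thresholds of higher prime powers *)

Lemma card_fibres (T T' : finType) (B : {set T}) (g : T -> T') n :
  (forall y, #|[set b in B | g b == y]| <= n) -> #|B| <= #|T'| * n.
Proof.
move=> fib; rewrite -sum1_card (partition_big g predT) //= -sum_nat_const.
by apply: leq_sum => y _; rewrite sum1dep_card fib.
Qed.

Lemma card_diameter n (F : {set 'I_n}) d :
  (forall b c : 'I_n, b \in F -> c \in F -> b < c -> c <= b + d) -> #|F| <= d.+1.
Proof.
move=> diam; have [->|[b0 b0F]] := set_0Vmem F; first by rewrite cards0.
case: (arg_minnP (fun b : 'I_n => b : nat) b0F) => b bF min_b.
rewrite cardE -(size_map (fun c : 'I_n => c : nat)) -[leqRHS](size_iota b).
apply: uniq_leq_size; first by rewrite map_inj_uniq ?enum_uniq //; apply: val_inj.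
move=> x /mapP[c]; rewrite mem_enum => cF ->; rewrite mem_iota addnS ltnS.
rewrite min_b //=; have := min_b c cF; rewrite leq_eqVlt => /orP[/eqP<-|].
  exact: leq_addr.
exact: diam.
Qed.

Section BadPairs.
Local Open Scope ring_scope.
Variable R : realType.

(** The weight step must be near [rho * ln p], which is at most [P] if [p <= P]. For [p > P] the
    step is at least [p * P], while [rho * ln p <= P / 8 * p]. *)
Lemma bad_pair_bound (P m p j : nat) : prime p -> (0 < j)%N -> (1 < P)%N ->
  8 <= ln (P%:R : R) -> (m <= P)%N -> `|cost_step R P p j| <= m%:R ->
  (p * p.-1 <= 2 * P)%N /\ (2 ^ j <= 2 * P)%N.
Proof.
move=> p_pr j_gt0 P_gt1 l8 le_mP; rewrite /cost_step.
have p_gt1 := prime_gt1 p_pr; have p_gt0 := ltnW p_gt1.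
have l_gt0 : 0 < ln (P%:R : R) by lra.
have P0 : 0 < P%:R :> R by rewrite ltr0n ltnW.
have p0 : 0 < p%:R :> R by rewrite ltr0n.
have pp : (p * p.-1 <= weight_step p j)%N.
  apply: leq_trans (weight_step_leq p_gt1 j_gt0).
  by rewrite /weight_step mul1n expn1 -subn1 mulnBr muln1 mulnn.
have pj : (2 ^ j <= weight_step p j)%N.
  rewrite /weight_step j_gt0 mul1n expnS -[X in (_ - X)%N]mul1n -mulnBl.
  apply: (@leq_trans (p ^ j)); first by rewrite leq_exp2r.
  by rewrite leq_pmull // subn_gt0.
rewrite ler_norml => /andP[_]; rewrite lerBlDl => le_step.
have le_mPR : m%:R <= P%:R :> R by rewrite ler_nat.
have ln_p : ln p%:R <= p%:R :> R by apply/ltW/ln_sublinear.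
have [le_pP|lt_Pp] := leqP p P.
  have le_rho : P%:R / ln P%:R * ln p%:R <= P%:R :> R.
    rewrite mulrAC ler_pdivrMr // ler_pM2l // ler_ln ?posrE //.
    by rewrite ler_nat.
  have : (weight_step p j <= 2 * P)%N by rewrite -(ler_nat R) natrM; lra.
  by move=> le2; split; apply: leq_trans le2.
exfalso.
have le_rho : P%:R / ln P%:R * ln p%:R <= P%:R / 8 * p%:R :> R.
  apply: ler_pM => //.
  - by rewrite divr_ge0 // ltW.
  - by rewrite ln_ge0 // ler1n.
  by rewrite (ler_wpM2l (ltW P0)) // lef_pV2 ?posrE.
have ppR : p%:R * P%:R <= (weight_step p j)%:R :> R.
  rewrite -natrM ler_nat (leq_trans _ pp) // leq_mul2l -ltnS prednK // lt_Pp orbT //.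
have P1 : 2 <= p%:R :> R by rewrite ler_nat.
nra.
Qed.

(** Both [P / ln P] and [P' / ln P'], times [ln p], lie within [m] of the same weight step. The
    growth of [x / ln x] and [ln p >= 1 / 2] then confine [P' - P]. *)
Lemma bad_pair_close (P P' m p j : nat) : prime p -> (0 < P)%N -> (P < P')%N ->
  8 <= ln (P%:R : R) ->
  `|cost_step R P p j| <= m%:R -> `|cost_step R P' p j| <= m%:R ->
  P'%:R - P%:R <= 8 * m%:R * ln (P'%:R : R).
Proof.
move=> p_pr P_gt0 lt_PP l8; rewrite /cost_step.
set v : R := (weight_step p j)%:R; set lp := ln p%:R.
have P0 : 0 < P%:R :> R by rewrite ltr0n.
have P'0 : 0 < P'%:R :> R by rewrite ltr0n (ltn_trans P_gt0).
have lp_ge : 1 / 2 <= lp :> R.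
  apply: le_trans (ln2_ge_half R) _; rewrite ler_ln ?posrE ?ltr0n ?prime_gt0 // ler_nat.
  exact: prime_gt1.
have le_ln : ln P%:R <= ln P'%:R :> R by rewrite ler_ln ?posrE // ler_nat ltnW.
have step : ln P'%:R - ln P%:R <= (P'%:R - P%:R) / P%:R :> R by apply: ln_diff_le.
set l := ln P%:R in l8 le_ln step *; set l' := ln P'%:R in le_ln step *.
have l0 : 0 < l by lra. have l'0 : 0 < l' by lra.
rewrite !ler_norml => /andP[_ b1] /andP[b2 _].
have m0 : 0 <= m%:R :> R by [].
set s := P'%:R - P%:R in step *.
have s0 : 0 < s by rewrite subr_gt0 ltr_nat.
have c1 : (v - m%:R) * l <= P%:R * lp.
  have -> : P%:R * lp = P%:R / l * lp * l by field; rewrite gt_eqF.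
  by rewrite ler_pM2r //; lra.
have c2 : P'%:R * lp <= (v + m%:R) * l'.
  have -> : P'%:R * lp = P'%:R / l' * lp * l' by field; rewrite gt_eqF.
  by rewrite ler_pM2r //; lra.
have d1 := ler_wpM2r (ltW l'0) c1; have d2 := ler_wpM2r (ltW l0) c2.
have d3 : P%:R * (l' - l) <= s.
  by have := ler_wpM2l (ltW P0) step; rewrite mulrCA mulfV ?gt_eqF // mulr1.
have d4 : lp * (P'%:R * l - P%:R * l') <= 2 * m%:R * l * l' by lra.
have d5 : s * (l - 1) <= P'%:R * l - P%:R * l' by rewrite /s in d3 *; lra.
have d6 : lp * (s * (l - 1)) <= 2 * m%:R * l * l'.
  by apply: le_trans d4; rewrite ler_wpM2l //; lra.
have d7 : s * l / 4 <= lp * (s * (l - 1)).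
  have -> : s * l / 4 = 1 / 2 * (s * (l / 2)) by field.
  apply: ler_pM => //; first by rewrite mulr_ge0 ?(ltW s0) // divr_ge0 // ltW.
  by rewrite ler_pM2l //; lra.
have d8 : s * l <= 8 * m%:R * l' * l by lra.
by rewrite ler_pM2r in d8.
Qed.

End BadPairs.

(** * An unobstructed block and the conclusion *)

Lemma ln_expn2 (R : realType) (e : nat) :
  (e%:R / 2 <= ln ((2 ^ e)%N%:R : R) <= e%:R)%R.
Proof.
have l2 : (1 / 2 <= ln 2 :> R)%R := ln2_ge_half R.
have l2' : (ln 2 <= 1 :> R)%R by have := @le_ln1Dx R 1%R; have -> : (1 + 1 = 2 :> R)%R by []; apply; lra.
rewrite natrX lnXn // -mulr_natl.
by have e0 : (0 <= e%:R :> R)%R := ler0n _ _; apply/andP; split; nra.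
Qed.

(** Pigeonhole: if every good block were obstructed, each would be charged to a pair [(p, j)] with
    [p <= H ^ 21] and [j <= H]. That accounts for at most [H ^ 22 * H ^ 2 * H ^ 6 = H ^ 30] blocks,
    fewer than the [H ^ 31] good ones. *)
Lemma unobstructed_block (R : realType) (i : nat) : let H := (2 ^ i) ^ 12 in
  0 < i -> 4 * 1920 * i <= 2 ^ i ->
  exists P, [/\ [/\ prime P, H ^ 27 <= P, (8 <= ln (P%:R : R))%R & (16 * ln P%:R ^+ 2 <= (P%:R : R))%R],
    has_close_swaps P (H ^ 12) (2 * (16 * 1920) ^ 2) &
    forall p j, prime p -> 0 < j -> ((H ^ 12)%:R < `|cost_step R P p j|)%R].
Proof.
move=> H i_gt0 u_large; have u_ge : 8 * (480 * i) <= 2 ^ i by clear H; lia.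
set m := H ^ 12; set C := 2 * _.
have le_uH : 2 ^ i <= H by rewrite -{1}[2 ^ i]expn1 leq_pexp2l // expn_gt0.
have H_gt0 : 0 < H by rewrite !expn_gt0.
have H_ge4 : 4 <= H by apply: leq_trans le_uH; apply: leq_trans u_ge; move: i_gt0; lia.
have HE : H = 2 ^ (12 * i) by rewrite /H -expnM mulnC.
have H1 n : 0 < H ^ n by rewrite expn_gt0 H_gt0.
have block (b : 'I_(H ^ 32)) : exists P, good_block i b ->
    [/\ prime P, b * H ^ 8 <= P < b.+1 * H ^ 8 & has_close_swaps P m C].
  case: (boolP (good_block i b)) => [/andP[ge_b dense_b]|_]; last by exists 0.
  have b_gt0 : 0 < b by apply: leq_trans ge_b.
  by have [P] := block_swaps i_gt0 (isT : 0 < 1920) u_large b_gt0 dense_b; exists P.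
have [f fP] := choice block.
have range (b : 'I_(H ^ 32)) : good_block i b -> [/\ H ^ 27 <= f b, f b < H ^ 40,
    (8 <= ln ((f b)%:R : R))%R & (ln ((f b)%:R : R) <= 480 * i%:R)%R].
  move=> good_b; have [P_pr /andP[ge_P lt_P] _] := fP b good_b.
  have ge27 : H ^ 27 <= f b.
    apply: leq_trans ge_P; rewrite -[27]/(19 + 8) expnD leq_mul2r.
    by case/andP: good_b => -> _; rewrite orbT.
  have lt40 : f b < H ^ 40.
    apply: leq_trans lt_P _; rewrite -[40]/(32 + 8) expnD leq_mul2r.
    by rewrite (ltn_ord b) orbT.
  have f_gt0 := prime_gt0 P_pr; split=> //.
    have : (ln ((2 ^ (12 * i * 27))%N%:R : R) <= ln (f b)%:R)%R.
      by rewrite ler_ln ?posrE ?ltr0n ?expn_gt0 // ler_nat expnM -HE.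
    have /andP[le_l _] := ln_expn2 R (12 * i * 27); apply: le_trans.
    apply: le_trans le_l; rewrite ler_pdivlMr // -natrM ler_nat.
    by move: i_gt0; lia.
  have /andP[_ le_l] := ln_expn2 R (480 * i); rewrite -natrM; apply: le_trans le_l.
  by rewrite ler_ln ?posrE ?ltr0n ?expn_gt0 // ler_nat -length40_expn; apply: ltnW.
have final (b : 'I_(H ^ 32)) : good_block i b ->
   (forall p j, prime p -> 0 < j -> (m%:R < `|cost_step R (f b) p j|)%R) ->
   exists P, [/\ [/\ prime P, H ^ 27 <= P, (8 <= ln (P%:R : R))%R & (16 * ln P%:R ^+ 2 <= (P%:R : R))%R],
    has_close_swaps P m C &
    forall p j, prime p -> 0 < j -> (m%:R < `|cost_step R P p j|)%R].
  move=> good_b large; exists (f b); have [P_pr _ sw] := fP b good_b.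
  have [ge27 _ l8 l_le] := range b good_b; split=> //; split=> //.
  have l_u : (ln ((f b)%:R : R) <= (2 ^ i)%:R)%R.
    by apply: le_trans l_le _; rewrite -natrM ler_nat (leq_trans _ u_ge) // leq_pmull.
  apply: (@le_trans _ _ (16 * (2 ^ i)%:R ^+ 2)%R).
    by rewrite ler_pM2l // ler_sqr ?nnegrE // (le_trans _ l8).
  rewrite -natrX -natrM ler_nat; apply: leq_trans ge27.
  apply: (@leq_trans (H ^ 2 * H ^ 2)); last by rewrite -expnD leq_pexp2l.
  by apply: leq_mul; [rewrite (_ : 16 = 4 ^ 2) // leq_exp2r | rewrite leq_exp2r].
apply: contrapT => none.
have bad (b : 'I_(H ^ 32)) : exists pj : nat * nat, good_block i b ->
    [/\ prime pj.1, 0 < pj.2 & (`|cost_step R (f b) pj.1 pj.2| <= m%:R)%R].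
  case: (boolP (good_block i b)) => [good_b|_]; last by exists (0, 0).
  apply: contrapT => noj; apply: none; apply: (final b good_b) => p j p_pr j_gt0.
  by rewrite ltNge; apply/negP => le_m; apply: noj; exists (p, j).
have [g gP] := choice bad.
have g_bound (b : 'I_(H ^ 32)) : good_block i b -> (g b).1 <= H ^ 21 /\ (g b).2 <= H.
  move=> good_b; have [p_pr j_gt0 le_m] := gP b good_b.
  have [ge27 lt40 l8 _] := range b good_b; have [P_pr _ _] := fP b good_b.
  have [|le_p le_j] := bad_pair_bound p_pr j_gt0 (prime_gt1 P_pr) l8 _ le_m.
    by apply: leq_trans ge27; rewrite leq_pexp2l.
  split.
    rewrite leqNgt; apply/negP => gt21.
    have : H ^ 21 * H ^ 21 <= 2 * f b.
      by apply: leq_trans le_p; apply: leq_mul; [apply: ltnW | rewrite -ltnS prednK ?prime_gt0].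
    apply/negP; rewrite -ltnNge; apply: (@leq_trans (2 * H ^ 40)).
      by rewrite ltn_mul2l.
    rewrite -expnD -[21 + 21]/(2 + 40) expnD leq_mul2r (leq_trans (n := H)) ?orbT //.
      by rewrite (leq_trans _ H_ge4).
    by rewrite -{1}[H]expn1 leq_pexp2l.
  have lt_j : 2 ^ (g b).2 < 2 ^ (480 * i).+1.
    by apply: leq_ltn_trans le_j _; rewrite expnS -length40_expn ltn_mul2l.
  rewrite ltn_exp2l // ltnS in lt_j; apply: leq_trans lt_j (leq_trans _ le_uH).
  by apply: leq_trans u_ge; rewrite leq_pmull.
pose B := [set b : 'I_(H ^ 32) | good_block i b].
have card_B : H ^ 31 <= #|B|.
  have := many_good_blocks i_gt0 u_large; rewrite big_mkord -sum1dep_card [in X in _ -> _ <= X]big_mkcond.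
  by under [X in _ -> _ <= X]eq_bigr => b _ do rewrite -[if _ then _ else _]/(nat_of_bool _).
pose g' b : 'I_(H ^ 21).+1 * 'I_H.+1 := (inord (g b).1, inord (g b).2).
(* Primes charged to the same pair differ by at most [8 * H ^ 12 * (480 * i) <= H ^ 13], that is by
   [H ^ 5] block lengths. *)
have fibres y : #|[set b in B | g' b == y]| <= (H ^ 5).+2.
  apply: card_diameter => b c; rewrite !inE => /andP[good_b /eqP gb] /andP[good_c /eqP gc] lt_bc.
  have [b1 b2] := g_bound b good_b; have [c1 c2] := g_bound c good_c.
  have [e1 e2] : (g b).1 = (g c).1 /\ (g b).2 = (g c).2.
    move: gb; rewrite -gc => -[/(congr1 val) /= E1 /(congr1 val) /= E2].
    by move: E1 E2; rewrite !inordK.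
  have [Pb /andP[_ lt_b] _] := fP b good_b; have [Pc /andP[ge_c _] _] := fP c good_c.
  have [_ _ l8 _] := range b good_b; have [_ _ _ l_le] := range c good_c.
  have lt_f : f b < f c.
    by apply: leq_trans lt_b (leq_trans _ ge_c); rewrite leq_mul2r lt_bc orbT.
  have [p_pr _ bad_b] := gP b good_b; have [_ _ bad_c] := gP c good_c.
  rewrite -e1 -e2 in bad_c.
  have := bad_pair_close p_pr (prime_gt0 Pb) lt_f l8 bad_b bad_c.
  have m0 : (0 <= 8 * m%:R :> R)%R by [].
  move=> /le_trans/(_ (ler_wpM2l m0 l_le)); rewrite lerBlDl -!natrM -natrD ler_nat => close.
  have : c * H ^ 8 <= (b + (H ^ 5).+1) * H ^ 8.
    apply: leq_trans ge_c (leq_trans close _).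
    rewrite -addSnnS mulnDl; apply: leq_add; first exact: ltnW.
    rewrite -expnD -[5 + 8]/(1 + 12) expnD expn1 -/m mulnAC leq_mul2r.
    by rewrite (leq_trans u_ge le_uH) orbT.
  by rewrite leq_mul2r (gtn_eqF (H1 8)).
have := leq_trans card_B (card_fibres fibres).
rewrite card_prod !card_ord; apply/negP; rewrite -ltnNge.
have two n : 0 < n -> (H ^ n).+2 <= H ^ n.+1.
  move=> n_gt0; rewrite expnS; have : H <= H ^ n by rewrite -{1}[H]expn1 leq_pexp2l.
  move=> leHn; apply: (@leq_trans (H ^ n + H ^ n)).
    by rewrite -addn2 leq_add2l (leq_trans _ leHn) // (leq_trans _ H_ge4).
  by rewrite addnn -mul2n leq_mul2r (leq_trans _ H_ge4) ?orbT.
have h21 : (H ^ 21).+1 <= H ^ 22 by apply: leq_trans (two 21 isT); apply: leqnSn.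
have h1 : H.+1 <= H ^ 2 by have := two 1 isT; rewrite expn1; apply: leq_trans; apply: leqnSn.
apply: (@leq_ltn_trans (H ^ 22 * H ^ 2 * H ^ 6)).
  by rewrite leq_mul ?two // leq_mul.
by rewrite -!expnD ltn_exp2l // (leq_trans _ H_ge4).
Qed.

Theorem theorem1 (R : realType) :
  (limn_einf (fun k : nat =>
     ((landau_seq k.+1)%:R - (landau_seq k)%:R : R)%R%:E) < +oo)%E.
Proof.
apply: limn_einf_gaps_of_close_jumps; exists (2 * (16 * 1920) ^ 2) => K.
(* 17 is the least positive [i] with [4 * 1920 * i <= 2 ^ i]; adding [K] makes the jumps exceed
   [K]. *)
pose i := K + 17; have i_gt0 : 0 < i by rewrite addn_gt0 orbT.
have u_large : 4 * 1920 * i <= 2 ^ i.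
  rewrite /i; elim: (K) => [|n IHn]; first by rewrite add0n; lia.
  by rewrite addSn expnS; move: IHn; lia.
have [P [[P_pr ge_P l8 l_small] swaps large]] := unobstructed_block R i_gt0 u_large.
have [S [Q1 [Q2 [[uS SP] [uQ1 Q1P] [uQ2 Q2P] [s1 s2] [leS lt12 leC lem]]]]] := swaps.
set H := (2 ^ i) ^ 12 in ge_P lem large.
have H_gt : K < H.
  apply: (@leq_trans (2 ^ i)).
    by apply: leq_ltn_trans (leq_addr 17 K) _; apply: ltn_expl.
  by rewrite -{1}[2 ^ i]expn1 leq_pexp2l // expn_gt0.
have H_gt64 : 64 < H.
  rewrite /H -expnM -[64]/(2 ^ 6) ltn_exp2l //; move: i_gt0; lia.
have m_small : 64 * (H ^ 12) ^ 2 < P.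
  apply: leq_trans ge_P; rewrite -expnM -[27]/(2 + (1 + 24)) expnD expnD expn1.
  have h24 : 0 < H ^ 24 by rewrite expn_gt0 (leq_trans _ H_gt64).
  apply: (@leq_trans (H * H ^ 24)); first by rewrite ltn_mul2r h24.
  by rewrite leq_pmull // expn_gt0 (leq_trans _ H_gt64).
have [n1 [n2 [le_P le_n J1 lt12']]] :=
  jumps_of_swaps P_pr l8 l_small m_small large uS SP uQ1 Q1P s1 uQ2 Q2P s2 leS lt12 lem.
exists n1, n2; split=> //; last by apply: leq_trans le_n _; rewrite leq_add2l leq_subLR.
apply: leq_trans H_gt (leq_trans _ le_P); apply: leq_trans ge_P.
by rewrite -{1}[H]expn1 leq_pexp2l // (leq_trans _ H_gt64).
Qed.
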